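(* Let $n\in\mathbb{N}_0$ and $d_{\mathrm{triv}}(n):=\lfloor n/2\rfloor-\lfloor (n-1)/3\rfloor$. The functions $b^{\mathrm{sym}}_{n,k}$, $0\le k\le d_{\mathrm{triv}}(n)-1$, defined by $b^{\mathrm{sym}}_{n,k}:=r_{n,n-2k}$ if $n$ is even and $b^{\mathrm{sym}}_{n,k}:=r_{n,n-1-2k}$ if $n$ is odd, form a basis of the space of totally symmetric polynomials in $\mathbb{P}^\perp_{n,n-1}(\widehat T)$.
   Context: $\widehat T$ is the triangle with vertices $(0,0),(1,0),(0,1)$. $\mathbb{P}^\perp_{0,-1}(\widehat T)=\mathbb{P}_0$; for $n\ge1$, $\mathbb{P}^\perp_{n,n-1}(\widehat T)$ is the space of polynomials of total degree $\le n$ that are $L^2(\widehat T)$-orthogonal to all polynomials of degree $\le n-1$. With Jacobi polynomials $P_m^{(\alpha,\beta)}$ (normalized by $P_m^{(\alpha,\beta)}(1)=(\alpha+1)_m/m!$) and Legendre polynomials $P_k^{(0,0)}$, set $b_{n,k}(x_1,x_2):=(x_1+x_2)^kP^{(0,2k+1)}_{n-k}(2(x_1+x_2)-1)P^{(0,0)}_k\!\left(\frac{x_1-x_2}{x_1+x_2}\right)$, $0\le k\le n$ (a basis of $\mathbb{P}^\perp_{n,n-1}(\widehat T)$). Let $Mp(x_1,x_2):=p(1-x_1-x_2,x_2)$, $Rp(x_1,x_2):=p(x_2,x_1)$, and let $M^{(n)}_{j,k}$ be defined by $Mb_{n,k}=\sum_{j=0}^nb_{n,j}M^{(n)}_{j,k}$.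 For $0\le k\le n/2$, $r_{n,2k}:=2\sum_{0\le j\le n/2}M^{(n)}_{2j,2k}b_{n,2j}+b_{n,2k}$. A function $u$ on $\widehat T$ is totally symmetric if $u\circ\chi=u$ for every affine bijection $\chi:\widehat T\to\widehat T$. *)

(* Defs.v *)
From Stdlib Require Import Reals Lra ZArith List ClassicalEpsilon.
From Coquelicot Require Import Coquelicot.
Open Scope R_scope.

Definition sumlt (d : nat) (f : nat -> R) : R :=
  fold_right Rplus 0 (map f (seq 0 d)).

(** binomial coefficient as a real (used only with k <= n) *)
Definition binR (n k : nat) : R :=
  INR (fact n) / (INR (fact k) * INR (fact (n - k))).

(** Jacobi polynomial P_m^{(a,b)}(t), for nonnegative integer a b,
    explicit classical formula; normalized by P_m^{(a,b)}(1) = (a+1)_m/m!. *)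
Definition jacobi (m a b : nat) (t : R) : R :=
  sumlt (S m) (fun s => binR (m + a) (m - s) * binR (m + b) s
                        * ((t - 1) / 2) ^ s * ((t + 1) / 2) ^ (m - s)).

(** Homogenized Jacobi polynomial: v^m * P_m^{(a,b)}(u/v), written out
    (this is the polynomial in (u,v) equal to it whenever v <> 0). *)
Definition jacobi_hom (m a b : nat) (u v : R) : R :=
  sumlt (S m) (fun s => binR (m + a) (m - s) * binR (m + b) s
                        * ((u - v) / 2) ^ s * ((u + v) / 2) ^ (m - s)).

(** b_{n,k}(x1,x2) = (x1+x2)^k P^{(0,2k+1)}_{n-k}(2(x1+x2)-1)
                      P^{(0,0)}_k((x1-x2)/(x1+x2)) *)
Definition bnk (n k : nat) (x1 x2 : R) : R :=
  jacobi (n - k) 0 (2 * k + 1) (2 * (x1 + x2) - 1)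
  * jacobi_hom k 0 0 (x1 - x2) (x1 + x2).

Definition Pspace (n : nat) (p : R -> R -> R) : Prop :=
  exists c : nat -> nat -> R, forall x y,
    p x y = sumlt (S n) (fun i => sumlt (S (n - i)) (fun j => c i j * x ^ i * y ^ j)).

Definition ipT (p q : R -> R -> R) : R :=
  RInt (fun x => RInt (fun y => p x y * q x y) 0 (1 - x)) 0 1.

(** P^perp_{n,n-1}(T): for n = 0 this is P_0 *)
Definition Pperp (n : nat) (p : R -> R -> R) : Prop :=
  Pspace n p /\ ((1 <= n)%nat -> forall q, Pspace (n - 1) q -> ipT p q = 0).

(** M^{(n)}_{j,k}: coefficients defined by  M b_{n,k} = sum_j b_{n,j} M_{j,k},
    with (M p)(x1,x2) = p(1-x1-x2, x2). Chosen by description; the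
    coefficients are unique since (b_{n,j})_j is a basis. *)
Definition Mrel (n : nat) (Mc : nat -> nat -> R) : Prop :=
  forall k, (k <= n)%nat -> forall x1 x2,
    bnk n k (1 - x1 - x2) x2 = sumlt (S n) (fun j => bnk n j x1 x2 * Mc j k).

Definition Mcoef (n : nat) : nat -> nat -> R :=
  epsilon (inhabits (fun _ _ => 0)) (Mrel n).

Definition rnk (n m : nat) (x1 x2 : R) : R :=
  2 * sumlt (S (Nat.div n 2)) (fun j => Mcoef n (2 * j) m * bnk n (2 * j) x1 x2)
  + bnk n m x1 x2.

Definition dtriv (n : nat) : nat :=
  Z.to_nat (Z.of_nat n / 2 - (Z.of_nat n - 1) / 3)%Z.

Definition bsym (n k : nat) : R -> R -> R :=
  if Nat.even n then rnk n (n - 2 * k) else rnk n (n - 1 - 2 * k).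

Definition inT (x y : R) : Prop := 0 <= x /\ 0 <= y /\ x + y <= 1.

Definition affine_map (a b c d e g : R) (x y : R) : R * R :=
  (a * x + b * y + e, c * x + d * y + g).

Definition affine_bij_T (a b c d e g : R) : Prop :=
  (forall x y, inT x y ->
     inT (fst (affine_map a b c d e g x y)) (snd (affine_map a b c d e g x y))) /\
  (forall u v, inT u v -> exists x y, inT x y /\ affine_map a b c d e g x y = (u, v)) /\
  (forall x y x' y', inT x y -> inT x' y' ->
     affine_map a b c d e g x y = affine_map a b c d e g x' y' -> x = x' /\ y = y').

Definition totally_symmetric (u : R -> R -> R) : Prop :=
  forall a b c d e g, affine_bij_T a b c d e g ->
    forall x y, inT x y ->
      u (fst (affine_map a b c d e g x y)) (snd (affine_map a b c d e g x y)) = u x y.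

(* Main.v *)
Require Import Defs.
From Stdlib Require Import Reals Lra Lia ZifyNat ZArith List FunctionalExtensionality.
From Stdlib Require Import ClassicalEpsilon.
From Coquelicot Require Import Coquelicot.
Open Scope R_scope.

(* Write s = x1 + x2.  Order the monomials s^c x1^i by total degree and then by i: the
   leading monomial of b_{n,k} is s^(n-k) x1^k, and b_{n,k} is orthogonal to all smaller
   monomials.  So (b_{n,k})_k is an orthogonal basis of the space, M exists, and r_{n,m}
   (m even) is the sum of the three functions in the S_3-orbit of b_{n,m}.

   Let e2, e3 be the elementary symmetric polynomials of the barycentric coordinates.  The
   leading monomial of e2^a e3^b, 2a + 3b = n, is s^b x1^(n-b), hence this symmetric polynomial
   is orthogonal to b_{n,m} for m > n - b and not orthogonal to b_{n,n-b}; the same holds for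
   r_{n,m}.  There are d_triv(n) such pairs (a, b), and n - b runs through the indices m of the
   functions b^sym_{n,k}, so the pairing of the e2^a e3^b with the b^sym_{n,k} is triangular
   and invertible, which gives independence.  Conversely subtract from a totally symmetric p
   the combination of the b^sym_{n,k} with the same pairings: the difference q is orthogonal to
   all e2^a e3^b with 2a + 3b = n and to all polynomials of lower degree, hence to all
   symmetric polynomials of degree n, in particular to itself. *)

(** * Finite sums *)

Lemma sumlt_S d f : sumlt (S d) f = sumlt d f + f d.
Proof.
  unfold sumlt. rewrite seq_S, map_app. simpl.
  induction (map f (seq 0 d)) as [|a l IH]; simpl; [ring | rewrite IH; ring].
Qed.

Lemma sumlt_0 f : sumlt 0 f = 0.
Proof. reflexivity. Qed.

Lemma sumlt_ext d f g : (forall k, (k < d)%nat -> f k = g k) -> sumlt d f = sumlt d g.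
Proof.
  induction d as [|d IH]; intros H; [reflexivity|].
  rewrite !sumlt_S, IH, H; auto with arith.
Qed.

Lemma sumlt_plus d f g : sumlt d (fun k => f k + g k) = sumlt d f + sumlt d g.
Proof. induction d; [unfold sumlt; simpl; ring | rewrite !sumlt_S, IHd; ring]. Qed.

Lemma sumlt_scal d a f : sumlt d (fun k => a * f k) = a * sumlt d f.
Proof. induction d; [unfold sumlt; simpl; ring | rewrite !sumlt_S, IHd; ring]. Qed.

Lemma sumlt_zero d f : (forall k, (k < d)%nat -> f k = 0) -> sumlt d f = 0.
Proof.
  intros H. rewrite (sumlt_ext d f (fun _ => 0 * 0)) by (intros; rewrite H; auto; ring).
  rewrite sumlt_scal. ring.
Qed.

Lemma sumlt_single d i f :
  (i < d)%nat -> (forall k, (k < d)%nat -> k <> i -> f k = 0) -> sumlt d f = f i.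
Proof.
  intros Hi H. induction d as [|d IH]; [lia|]. rewrite sumlt_S.
  destruct (Nat.eq_dec i d) as [->|Hd].
  - rewrite sumlt_zero; [ring|]. intros k Hk. apply H; lia.
  - rewrite IH, (H d); [ring | lia | lia | lia | intros; apply H; lia].
Qed.

Lemma sumlt_first d f : sumlt (S d) f = f 0%nat + sumlt d (fun k => f (S k)).
Proof.
  induction d as [|d IH]; [unfold sumlt; simpl; ring|].
  rewrite sumlt_S, IH, (sumlt_S d). ring.
Qed.

Lemma sumlt_rev d f : sumlt (S d) f = sumlt (S d) (fun k => f (d - k)%nat).
Proof.
  revert f. induction d as [|d IH]; intros f; [reflexivity|].
  rewrite sumlt_S, IH, (sumlt_first (S d) (fun k => f (S d - k)%nat)).
  rewrite Nat.sub_0_r, Rplus_comm. reflexivity.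
Qed.

Lemma sumlt_pos d f : (forall k, (k < S d)%nat -> 0 < f k) -> 0 < sumlt (S d) f.
Proof.
  induction d as [|d IH]; intros H; rewrite sumlt_S.
  - rewrite sumlt_0, Rplus_0_l. auto.
  - assert (0 < f (S d)) by auto. assert (0 < sumlt (S d) f) by auto. lra.
Qed.

Lemma sumlt_nonneg_zero d f : (forall k, (k < d)%nat -> 0 <= f k) ->
  sumlt d f = 0 -> forall k, (k < d)%nat -> f k = 0.
Proof.
  intros Hf. assert (Hs : forall m, (m <= d)%nat -> 0 <= sumlt m f).
  { induction m as [|m IH]; intros Hm; [apply Rle_refl|]. rewrite sumlt_S.
    apply Rplus_le_le_0_compat; [apply IH | apply Hf]; lia. }
  induction d as [|d IH]; intros H k Hk; [lia|]. rewrite sumlt_S in H.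
  assert (H1 := Hs d ltac:(lia)). assert (H2 := Hf d ltac:(lia)).
  destruct (Nat.eq_dec k d) as [->|]; [lra|].
  apply IH; [intros; apply Hf; lia | intros; apply Hs; lia | lra | lia].
Qed.

(** The weight [1 + (-1)^j] kills odd [j] and doubles even [j]; this produces the factor 2 and the
    even-index sum in [rnk]. *)
Lemma sumlt_even_part n f :
  sumlt (S n) (fun j => (1 + (-1) ^ j) * f j)
  = 2 * sumlt (S (Nat.div n 2)) (fun j => f (2 * j)%nat).
Proof.
  assert (H : forall m, sumlt (2 * m) (fun j => (1 + (-1) ^ j) * f j)
                        = 2 * sumlt m (fun j => f (2 * j)%nat)).
  { induction m as [|m IH]; [unfold sumlt; simpl; ring|].
    replace (2 * S m)%nat with (S (S (2 * m))) by lia.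
    rewrite !sumlt_S, IH. rewrite pow_1_even. rewrite pow_1_odd. ring. }
  destruct (Nat.Even_or_Odd n) as [[m ->]|[m ->]].
  - replace (Nat.div (2 * m) 2) with m
      by (rewrite Nat.mul_comm, Nat.div_mul; lia).
    rewrite !sumlt_S, H, pow_1_even. ring.
  - replace (Nat.div (2 * m + 1) 2) with m
      by (rewrite Nat.mul_comm, Nat.div_add_l; simpl; lia).
    replace (S (2 * m + 1)) with (2 * S m)%nat by lia. apply H.
Qed.

(** Back substitution: the last equation contains only the last unknown, which therefore vanishes
    and drops out of the remaining equations. *)
Lemma triangular_zero d (g : nat -> nat -> R) (c : nat -> R) :
  (forall k j, (j < k)%nat -> (k < d)%nat -> g k j = 0) ->
  (forall k, (k < d)%nat -> g k k <> 0) ->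
  (forall k, (k < d)%nat -> sumlt d (fun j => g k j * c j) = 0) ->
  forall k, (k < d)%nat -> c k = 0.
Proof.
  induction d as [|d IH]; intros Ht Hd Hs k Hk; [lia|].
  assert (Hc : c d = 0).
  { assert (H := Hs d ltac:(lia)).
    rewrite (sumlt_single _ d) in H; [| lia | intros; rewrite Ht; [ring | lia | lia]].
    apply Rmult_integral in H. destruct H as [H|H]; auto. destruct (Hd d); auto. }
  destruct (Nat.eq_dec k d) as [->|Hkd]; [exact Hc|].
  apply IH; [intros; apply Ht; lia | intros; apply Hd; lia | | lia].
  intros k' Hk'. assert (H := Hs k' ltac:(lia)). rewrite sumlt_S, Hc in H. lra.
Qed.

Lemma triangular_solve d (g : nat -> nat -> R) :
  (forall k j, (j < k)%nat -> (k < d)%nat -> g k j = 0) ->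
  (forall k, (k < d)%nat -> g k k <> 0) ->
  forall t : nat -> R, exists c : nat -> R,
    forall k, (k < d)%nat -> sumlt d (fun j => g k j * c j) = t k.
Proof.
  induction d as [|d IH]; intros Ht Hd t; [exists t; lia|].
  (* The last unknown is forced to be [t d / g d d]; its contribution to the other equations moves
     to the right-hand side. *)
  destruct (IH ltac:(intros; apply Ht; lia) ltac:(intros; apply Hd; lia)
              (fun k => t k - g k d * (t d / g d d))) as [c Hc].
  exists (fun j => if Nat.eq_dec j d then t d / g d d else c j).
  intros k Hk. rewrite sumlt_S. destruct (Nat.eq_dec d d) as [_|]; [|lia].
  rewrite (sumlt_ext _ _ (fun j => g k j * c j))
    by (intros j Hj; destruct (Nat.eq_dec j d); [lia | reflexivity]).
  destruct (Nat.eq_dec k d) as [->|Hkd].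
  - rewrite sumlt_zero; [field; auto | intros; rewrite Ht; [ring | lia | lia]].
  - rewrite Hc by lia. ring.
Qed.

(** * Polynomial functions *)

Definition fn := R -> R -> R.

(** The linear hull in inductive form, so that linear statements are proved by induction from the
    generators. *)
Inductive span (G : fn -> Prop) : fn -> Prop :=
| span_0 : span G (fun _ _ => 0)
| span_gen f : G f -> span G f
| span_add f g : span G f -> span G g -> span G (fun x y => f x y + g x y)
| span_scal a f : span G f -> span G (fun x y => a * f x y).

Lemma fn_ext (f g : fn) : (forall x y, f x y = g x y) -> f = g.
Proof. intros H. extensionality x. extensionality y. apply H. Qed.

Lemma span_ext G f g : span G f -> (forall x y, f x y = g x y) -> span G g.
Proof. intros Hf H. rewrite <- (fn_ext f g); auto. Qed.

Lemma span_sub G H f : (forall g, G g -> span H g) -> span G f -> span H f.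
Proof. intros GH. induction 1; [apply span_0 | auto | apply span_add | apply span_scal]; auto. Qed.

Lemma span_minus G f g : span G f -> span G g -> span G (fun x y => f x y - g x y).
Proof.
  intros Hf Hg. apply (span_ext _ (fun x y => f x y + -1 * g x y)); [|intros; ring].
  apply span_add; [|apply span_scal]; auto.
Qed.

Lemma span_sum G d (f : nat -> fn) :
  (forall k, (k < d)%nat -> span G (f k)) -> span G (fun x y => sumlt d (fun k => f k x y)).
Proof.
  induction d as [|d IH]; intros H; [apply span_0|].
  apply (span_ext _ (fun x y => sumlt d (fun k => f k x y) + f d x y)).
  - apply span_add; [apply IH; auto | apply H; auto].
  - intros. now rewrite sumlt_S.
Qed.

Lemma span_mul (G H K : fn -> Prop) :
  (forall f g, G f -> H g -> span K (fun x y => f x y * g x y)) ->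
  forall f g, span G f -> span H g -> span K (fun x y => f x y * g x y).
Proof.
  intros GH f g Hf Hg. induction Hf as [|f Gf|f1 f2 _ IH1 _ IH2|a f _ IH].
  - apply (span_ext _ (fun _ _ => 0)); [apply span_0 | intros; ring].
  - induction Hg as [|g Hg|g1 g2 _ IH1 _ IH2|a g _ IH].
    + apply (span_ext _ (fun _ _ => 0)); [apply span_0 | intros; ring].
    + auto.
    + eapply span_ext; [exact (span_add _ _ _ IH1 IH2) | intros; simpl; ring].
    + eapply span_ext; [exact (span_scal _ a _ IH) | intros; simpl; ring].
  - eapply span_ext; [exact (span_add _ _ _ IH1 IH2) | intros; simpl; ring].
  - eapply span_ext; [exact (span_scal _ a _ IH) | intros; simpl; ring].
Qed.

Definition mon (c i : nat) : fn := fun x y => (x + y) ^ c * x ^ i.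

(** The degree bound is strict: [dg (S n)] holds the polynomials of degree at most [n], and [dg 0]
    is the zero space, which makes the case of no lower degrees uniform. *)
Definition dg (n : nat) : fn -> Prop :=
  span (fun f => exists c i, (c + i < n)%nat /\ f = mon c i).

Definition xymon (i j : nat) : fn := fun x y => x ^ i * y ^ j.

Definition dgxy (n : nat) : fn -> Prop :=
  span (fun f => exists i j, (i + j < n)%nat /\ f = xymon i j).

Lemma dg_mon n c i : (c + i < n)%nat -> dg n (mon c i).
Proof. intros H. apply span_gen. eauto. Qed.

Lemma dg_le n m f : (n <= m)%nat -> dg n f -> dg m f.
Proof.
  intros H. apply span_sub. intros g (c & i & Hci & ->). apply dg_mon. lia.
Qed.

Lemma dg_mul a b f g :
  dg (S a) f -> dg b g -> dg (a + b) (fun x y => f x y * g x y).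
Proof.
  apply span_mul. intros f' g' (c & i & H & ->) (c' & i' & H' & ->).
  apply (span_ext _ (mon (c + c') (i + i'))); [apply dg_mon; lia|].
  intros. unfold mon. rewrite !pow_add. ring.
Qed.

Lemma dg_const n a : dg (S n) (fun _ _ => a).
Proof.
  apply (span_ext _ (fun x y => a * mon 0 0 x y)); [|intros; unfold mon; simpl; ring].
  apply span_scal, dg_mon. lia.
Qed.

Lemma dg_pow a k f : dg (S a) f -> dg (S (k * a)) (fun x y => f x y ^ k).
Proof.
  intros H. induction k as [|k IH]; simpl; [apply dg_const|].
  apply (dg_le (a + S (k * a))); [lia|]. now apply dg_mul.
Qed.

Lemma dg_x : dg 2 (fun x _ => x).
Proof.
  apply (span_ext _ (mon 0 1)); [apply dg_mon; lia | intros; unfold mon; simpl; ring].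
Qed.

Lemma dg_s : dg 2 (fun x y => x + y).
Proof.
  apply (span_ext _ (mon 1 0)); [apply dg_mon; lia | intros; unfold mon; simpl; ring].
Qed.

Lemma dg_y : dg 2 (fun _ y => y).
Proof.
  eapply span_ext; [exact (span_minus _ _ _ dg_s dg_x) | intros; simpl; ring].
Qed.

Lemma dg_third : dg 2 (fun x y => 1 - x - y).
Proof.
  eapply span_ext; [exact (span_minus _ _ _ (dg_const 1 1) dg_s) | intros; simpl; ring].
Qed.

Lemma dgxy_dg n f : dgxy n f -> dg n f.
Proof.
  apply span_sub. intros g (i & j & H & ->).
  assert (Hx := dg_pow 1 i _ dg_x). assert (Hy := dg_pow 1 j _ dg_y).
  apply (dg_le (i * 1 + S (j * 1))); [lia|]. exact (dg_mul _ _ _ _ Hx Hy).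
Qed.

Lemma dg_dgxy n f : dg n f -> dgxy n f.
Proof.
  apply span_sub. intros g (c & i & H & ->).
  (* Generalized to a factor [x^i * y^j], so that the induction on [c] can expand one factor [x + y]
     at a time. *)
  enough (E : forall c i j, (c + i + j < n)%nat ->
                dgxy n (fun x y => (x + y) ^ c * xymon i j x y)).
  { eapply span_ext; [apply (E c i 0%nat); lia|].
    intros; unfold mon, xymon; simpl; ring. }
  clear c i H. induction c as [|c IH]; intros i j H.
  - eapply span_ext; [apply span_gen; exists i, j; split; [lia | reflexivity]|].
    intros; simpl; ring.
  - eapply span_ext;
      [exact (span_add _ _ _ (IH (S i) j ltac:(lia)) (IH i (S j) ltac:(lia)))|].
    intros; unfold xymon; simpl; ring.
Qed.

Lemma Pspace_dg n p : Pspace n p <-> dg (S n) p.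
Proof.
  split.
  - intros [c Hc]. apply dgxy_dg.
    eapply span_ext; [|intros x y; symmetry; apply Hc].
    apply (span_sum _ _ (fun i x y => _)). intros i Hi.
    apply (span_sum _ _ (fun j x y => _)). intros j Hj.
    apply (span_ext _ (fun x y => c i j * xymon i j x y)).
    + apply span_scal, span_gen. exists i, j. split; [lia | reflexivity].
    + intros. unfold xymon. ring.
  - intros H. apply dg_dgxy in H.
    induction H as [|f (i & j & Hij & ->)|f g _ [c Hc] _ [d Hd]|a f _ [c Hc]].
    + exists (fun _ _ => 0). intros. symmetry. apply sumlt_zero. intros.
      apply sumlt_zero. intros. ring.
    + exists (fun i' j' => if Nat.eq_dec i' i then if Nat.eq_dec j' j then 1 else 0 else 0).
      intros x y. rewrite (sumlt_single _ i); [|lia|].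
      * rewrite (sumlt_single _ j); [|lia|].
        -- destruct (Nat.eq_dec i i), (Nat.eq_dec j j); try lia. unfold xymon. ring.
        -- intros k _ Hk. destruct (Nat.eq_dec i i), (Nat.eq_dec k j); try lia; ring.
      * intros k _ Hk. apply sumlt_zero. intros.
        destruct (Nat.eq_dec k i); [lia | ring].
    + exists (fun i j => c i j + d i j). intros. rewrite Hc, Hd, <- sumlt_plus.
      apply sumlt_ext. intros. rewrite <- sumlt_plus. apply sumlt_ext. intros. ring.
    + exists (fun i j => a * c i j). intros. rewrite Hc, <- sumlt_scal.
      apply sumlt_ext. intros. rewrite <- sumlt_scal. apply sumlt_ext. intros. ring.
Qed.

(** [swap] and [refl] are the operators R and M. Each exchanges two vertices of the triangle;
    together they generate its symmetry group. *)
Definition swap (f : fn) : fn := fun x y => f y x.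
Definition refl (f : fn) : fn := fun x y => f (1 - x - y) y.

Lemma dg_swap n f : dg n f -> dg n (swap f).
Proof.
  induction 1 as [|f (c & i & H & ->)|f g _ Hf _ Hg|a f _ Hf].
  - apply span_0.
  - eapply dg_le;
      [|eapply span_ext;
        [exact (dg_mul _ _ _ _ (dg_pow 1 c _ dg_s) (dg_pow 1 i _ dg_y))|]]; [lia|].
    intros; unfold swap, mon; simpl. now rewrite Rplus_comm.
  - now apply span_add.
  - now apply span_scal.
Qed.

Lemma dg_refl n f : dg n f -> dg n (refl f).
Proof.
  induction 1 as [|f (c & i & H & ->)|f g _ Hf _ Hg|a f _ Hf].
  - apply span_0.
  - assert (H1 := span_minus _ _ _ (dg_const 1 1) dg_x).
    eapply dg_le;
      [|eapply span_ext;
        [exact (dg_mul _ _ _ _ (dg_pow 1 c _ H1) (dg_pow 1 i _ dg_third))|]]; [lia|].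
    intros; unfold refl, mon; simpl. f_equal. f_equal. ring.
  - now apply span_add.
  - now apply span_scal.
Qed.

(** * Integration over the triangle *)

(** Euler's Beta function at [(i + 1, j + 1)]. *)
Definition beta (i j : nat) : R := INR (fact i) * INR (fact j) / INR (fact (i + j + 1)).

Lemma INR_fact_pos k : 0 < INR (fact k).
Proof. apply INR_fact_lt_0. Qed.

Lemma fact_S_INR k : INR (fact (S k)) = (INR k + 1) * INR (fact k).
Proof. now rewrite fact_simpl, mult_INR, S_INR. Qed.

Lemma INR_S_neq k : INR k + 1 <> 0.
Proof. assert (H := pos_INR k). lra. Qed.

Lemma beta_0_r i : beta i 0 = / (INR i + 1).
Proof.
  unfold beta. replace (i + 0 + 1)%nat with (S i) by lia. rewrite fact_S_INR.
  simpl (fact 0). change (INR 1) with 1.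
  field. split; [apply INR_S_neq | apply INR_fact_neq_0].
Qed.

Lemma beta_sym i j : beta i j = beta j i.
Proof. unfold beta. rewrite (Nat.add_comm i j). f_equal. ring. Qed.

Lemma beta_split i j : beta (S i) j + beta i (S j) = beta i j.
Proof.
  unfold beta. replace (S i + j + 1)%nat with (S (i + j + 1)) by lia.
  replace (i + S j + 1)%nat with (S (i + j + 1)) by lia.
  rewrite !fact_S_INR, !plus_INR. change (INR 1) with 1.
  assert (Hi := pos_INR i). assert (Hj := pos_INR j).
  field. split; [apply INR_fact_neq_0 | lra].
Qed.

(** Induction on [i]: writing one factor [x] as [1 - (1 - x)] gives the recursion [beta_split]. For
    [i = 0] a primitive is explicit. *)
Lemma is_RInt_beta i j : is_RInt (fun x => x ^ i * (1 - x) ^ j) 0 1 (beta i j).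
Proof.
  revert j. induction i as [|i IH]; intros j.
  - rewrite beta_sym, beta_0_r. assert (Hj := INR_S_neq j).
    replace (/ (INR j + 1)) with
      (- (1 - 1) ^ S j / (INR j + 1) - - (1 - 0) ^ S j / (INR j + 1)).
    2: { rewrite Rminus_diag, Rminus_0_r, pow1, pow_ne_zero by lia. field. exact Hj. }
    apply (is_RInt_derive (fun x => - (1 - x) ^ S j / (INR j + 1))).
    + intros x _. auto_derive; [exact I|].
      assert (E := S_INR j). simpl in E |- *. rewrite E. unfold Rminus. field. exact Hj.
    + intros x _. apply (ex_derive_continuous (V := R_NormedModule)). auto_derive. exact I.
  - replace (beta (S i) j) with (beta i j - beta i (S j)) by (rewrite <- beta_split; ring).
    apply (is_RInt_ext (fun x => minus (x ^ i * (1 - x) ^ j) (x ^ i * (1 - x) ^ S j))).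
    + intros. unfold minus, plus, opp; simpl. ring.
    + apply (is_RInt_minus (V := R_NormedModule)); apply IH.
Qed.

Definition integral (p : fn) : R := RInt (fun x => RInt (fun y => p x y) 0 (1 - x)) 0 1.

Definition integrable (p : fn) : Prop :=
  (forall x, ex_RInt (fun y => p x y) 0 (1 - x)) /\
  ex_RInt (fun x => RInt (fun y => p x y) 0 (1 - x)) 0 1.

Lemma integrable_add f g : integrable f -> integrable g ->
  integrable (fun x y => f x y + g x y) /\
  integral (fun x y => f x y + g x y) = integral f + integral g.
Proof.
  intros [Hf1 Hf2] [Hg1 Hg2].
  assert (E : forall x, RInt (fun y => f x y + g x y) 0 (1 - x)
               = RInt (fun y => f x y) 0 (1 - x) + RInt (fun y => g x y) 0 (1 - x)).
  { intros x. apply (RInt_plus (V := R_CompleteNormedModule)); auto. }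
  split; [split|].
  - intros x. apply (ex_RInt_plus (V := R_NormedModule)); auto.
  - apply (ex_RInt_ext (fun x => RInt (fun y => f x y) 0 (1 - x)
                                 + RInt (fun y => g x y) 0 (1 - x))).
    + intros; now rewrite E.
    + apply (ex_RInt_plus (V := R_NormedModule)); auto.
  - unfold integral. rewrite (RInt_ext _ (fun x => RInt (fun y => f x y) 0 (1 - x)
                                 + RInt (fun y => g x y) 0 (1 - x))).
    + apply (RInt_plus (V := R_CompleteNormedModule)); auto.
    + intros; apply E.
Qed.

Lemma integrable_scal a f : integrable f ->
  integrable (fun x y => a * f x y) /\ integral (fun x y => a * f x y) = a * integral f.
Proof.
  intros [Hf1 Hf2].
  assert (E : forall x, RInt (fun y => a * f x y) 0 (1 - x)
               = a * RInt (fun y => f x y) 0 (1 - x)).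
  { intros x. apply (RInt_scal (V := R_CompleteNormedModule)); auto. }
  split; [split|].
  - intros x. apply (ex_RInt_scal (V := R_NormedModule)); auto.
  - apply (ex_RInt_ext (fun x => a * RInt (fun y => f x y) 0 (1 - x))).
    + intros; now rewrite E.
    + apply (ex_RInt_scal (V := R_NormedModule)); auto.
  - unfold integral. rewrite (RInt_ext _ (fun x => a * RInt (fun y => f x y) 0 (1 - x))).
    + apply (RInt_scal (V := R_CompleteNormedModule)); auto.
    + intros; apply E.
Qed.

Lemma integrable_xymon i j :
  integrable (xymon i j) /\ integral (xymon i j) = beta i j / (INR (i + j) + 2).
Proof.
  assert (Hj := INR_S_neq j).
  assert (E : forall x, is_RInt (fun y => xymon i j x y) 0 (1 - x)
                (/ (INR j + 1) * (x ^ i * (1 - x) ^ S j))).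
  { intros x. unfold xymon.
    replace (/ (INR j + 1) * (x ^ i * (1 - x) ^ S j)) with
      (x ^ i * (1 - x) ^ S j / (INR j + 1) - x ^ i * 0 ^ S j / (INR j + 1))
      by (rewrite (pow_ne_zero (S j)) by lia; field; exact Hj).
    apply (is_RInt_derive (fun y => x ^ i * y ^ S j / (INR j + 1))).
    + intros y _. auto_derive; [exact I|].
      assert (E := S_INR j). simpl in E |- *. rewrite E. unfold Rminus. field. exact Hj.
    + intros y _. apply (ex_derive_continuous (V := R_NormedModule)). auto_derive. exact I. }
  assert (E2 : is_RInt (fun x => RInt (fun y => xymon i j x y) 0 (1 - x)) 0 1
                 (/ (INR j + 1) * beta i (S j))).
  { apply (is_RInt_ext (fun x => / (INR j + 1) * (x ^ i * (1 - x) ^ S j))).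
    - intros x _. symmetry. apply is_RInt_unique, E.
    - apply (is_RInt_scal (V := R_NormedModule)). apply is_RInt_beta. }
  split; [split|].
  - intros x. eexists. apply E.
  - eexists. apply E2.
  - unfold integral. rewrite (is_RInt_unique _ _ _ _ E2). unfold beta.
    replace (i + S j + 1)%nat with (S (i + j + 1)) by lia.
    rewrite !fact_S_INR, !plus_INR. change (INR 1) with 1.
    assert (Hi := pos_INR i). assert (Hj' := pos_INR j).
    field. repeat split; try lra. apply INR_fact_neq_0.
Qed.

Lemma integral_0 : integrable (fun _ _ => 0) /\ integral (fun _ _ => 0) = 0.
Proof.
  assert (H := integrable_scal 0 _ (proj1 (integrable_xymon 0 0))).
  replace (fun _ _ => 0) with (fun x y => 0 * xymon 0 0 x y)
    by (apply fn_ext; intros; ring).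
  split; [apply H|]. rewrite (proj2 H). ring.
Qed.

Lemma dg_integrable n f : dg n f -> integrable f.
Proof.
  intros H. apply dg_dgxy in H.
  induction H as [|f (i & j & _ & ->)|f g _ Hf _ Hg|a f _ Hf].
  - apply integral_0.
  - apply integrable_xymon.
  - now apply integrable_add.
  - now apply integrable_scal.
Qed.

Lemma integral_add n f g : dg n f -> dg n g ->
  integral (fun x y => f x y + g x y) = integral f + integral g.
Proof. intros Hf Hg. apply integrable_add; eapply dg_integrable; eassumption. Qed.

Lemma integral_scal n a f : dg n f -> integral (fun x y => a * f x y) = a * integral f.
Proof. intros Hf. apply integrable_scal; eapply dg_integrable; eassumption. Qed.

Lemma integral_sub n f g : dg n f -> dg n g ->
  integral (fun x y => f x y - g x y) = integral f - integral g.
Proof.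
  intros Hf Hg. replace (fun x y => f x y - g x y) with (fun x y => f x y + -1 * g x y)
    by (apply fn_ext; intros; ring).
  rewrite (integral_add n), (integral_scal n); auto; [ring | now apply span_scal].
Qed.

Lemma integral_sum n d (f : nat -> fn) : (forall k, (k < d)%nat -> dg n (f k)) ->
  integral (fun x y => sumlt d (fun k => f k x y)) = sumlt d (fun k => integral (f k)).
Proof.
  induction d as [|d IH]; intros H; [apply integral_0|].
  replace (fun x y => sumlt (S d) (fun k => f k x y))
    with (fun x y => sumlt d (fun k => f k x y) + f d x y)
    by (apply fn_ext; intros; now rewrite sumlt_S).
  assert (H' : forall k, (k < d)%nat -> dg n (f k)) by auto.
  rewrite sumlt_S, (integral_add n), (IH H'); [reflexivity | now apply span_sum | apply H; lia].
Qed.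

Lemma integral_ext_T f g :
  (forall x y, inT x y -> f x y = g x y) -> integral f = integral g.
Proof.
  intros H. apply RInt_ext. rewrite Rmin_left, Rmax_right by lra. intros x Hx.
  apply RInt_ext. rewrite Rmin_left, Rmax_right by lra. intros y Hy.
  apply H. unfold inT. lra.
Qed.

(** On monomials the integral is explicit and symmetric in the two exponents; linearity extends this
    to all polynomials. *)
Lemma integral_swap n f : dg n f -> integral (swap f) = integral f.
Proof.
  intros H. apply dg_dgxy in H.
  induction H as [|f (i & j & _ & ->)|f g Hf IHf Hg IHg|a f Hf IHf].
  - reflexivity.
  - replace (swap (xymon i j)) with (xymon j i)
      by (apply fn_ext; intros; unfold swap, xymon; ring).
    rewrite !(proj2 (integrable_xymon _ _)), beta_sym. now rewrite (Nat.add_comm i j).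
  - apply dgxy_dg in Hf, Hg. change (integral (fun x y => swap f x y + swap g x y)
      = integral (fun x y => f x y + g x y)).
    rewrite !(integral_add n); auto using dg_swap. now rewrite IHf, IHg.
  - apply dgxy_dg in Hf. change (integral (fun x y => a * swap f x y)
      = integral (fun x y => a * f x y)).
    rewrite !(integral_scal n); auto using dg_swap. now rewrite IHf.
Qed.

(* [refl] is conjugate under [swap] to [y |-> 1 - x - y], which only affects the inner integral. *)
Lemma integral_refl n f : dg n f -> integral (refl f) = integral f.
Proof.
  intros H.
  assert (E : forall g, dg n g -> integral (fun x y => g x (1 - x - y)) = integral g).
  { intros g Hg. apply RInt_ext. intros x _.
    assert (Hx : ex_RInt (fun y => g x y) 0 (1 - x)) by apply (dg_integrable n g Hg).
    rewrite <- (opp_RInt_swap (V := R_CompleteNormedModule) (fun y => g x y)) by now apply ex_RInt_swap.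
    assert (C := RInt_comp_lin (V := R_CompleteNormedModule)
                   (fun y => g x y) (-1) (1 - x) 0 (1 - x)).
    replace (-1 * 0 + (1 - x)) with (1 - x) in C by ring.
    replace (-1 * (1 - x) + (1 - x)) with 0 in C by ring.
    rewrite <- C by now apply ex_RInt_swap.
    rewrite <- (RInt_opp (V := R_CompleteNormedModule)).
    - apply RInt_ext. intros y _. unfold opp, scal; simpl. unfold mult; simpl.
      replace (-1 * y + (1 - x)) with (1 - x - y) by ring. ring.
    - apply (ex_RInt_comp_lin (V := R_NormedModule) (fun y => g x y)).
      replace (-1 * 0 + (1 - x)) with (1 - x) by ring.
      replace (-1 * (1 - x) + (1 - x)) with 0 by ring. now apply ex_RInt_swap. }
  assert (Hr : dg n (fun x y => f (1 - y - x) x)).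
  { exact (dg_swap _ _ (dg_refl _ _ H)). }
  rewrite <- (integral_swap n (refl f)) by now apply dg_refl.
  rewrite <- (integral_swap n f H), <- (E (swap f)) by now apply dg_swap.
  unfold swap, refl. f_equal. apply fn_ext. intros. f_equal. ring.
Qed.

(* In the coordinates [(x + y, x / (x + y))] the integral splits into two beta integrals. *)
Lemma integral_prod c d i j :
  integral (fun x y => (x + y) ^ c * (1 - (x + y)) ^ d * xymon i j x y)
  = beta i j * beta (c + i + j + 1) d.
Proof.
  assert (D : forall c d i j, exists n,
    dg n (fun x y => (x + y) ^ c * (1 - (x + y)) ^ d * xymon i j x y)).
  { clear. intros c d i j.
    assert (H1 := dg_pow 1 c _ dg_s).
    assert (H2 := dg_pow 1 d _ (span_minus _ _ _ (dg_const 1 1) dg_s)).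
    assert (H3 : dg (S (i + j)) (xymon i j)).
    { apply dgxy_dg, span_gen. exists i, j. split; [lia | reflexivity]. }
    assert (H12 := dg_mul _ _ _ _ H1 H2). rewrite <- plus_n_Sm in H12.
    eexists. exact (dg_mul _ _ _ _ H12 H3). }
  (* The factors are removed one at a time, first [1 - (x + y)] by subtraction and then [x + y] by
     addition; [beta_split] matches both recursions, and the bottom case is a single monomial. *)
  revert c i j. induction d as [|d IHd].
  - induction c as [|c IHc]; intros i j.
    + replace (fun x y => (x + y) ^ 0 * (1 - (x + y)) ^ 0 * xymon i j x y) with (xymon i j)
        by (apply fn_ext; intros; simpl; ring).
      rewrite (proj2 (integrable_xymon i j)), beta_0_r, !plus_INR. simpl. field.
      assert (Hi := pos_INR i). assert (Hj := pos_INR j). lra.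
    + replace (fun x y => (x + y) ^ S c * (1 - (x + y)) ^ 0 * xymon i j x y)
        with (fun x y => (x + y) ^ c * (1 - (x + y)) ^ 0 * xymon (S i) j x y
                       + (x + y) ^ c * (1 - (x + y)) ^ 0 * xymon i (S j) x y)
        by (apply fn_ext; intros; unfold xymon; simpl; ring).
      destruct (D c 0%nat (S i) j) as [n1 D1]. destruct (D c 0%nat i (S j)) as [n2 D2].
      rewrite (integral_add (n1 + n2)), !IHc.
      2: { apply (dg_le n1); [lia | exact D1]. }
      2: { apply (dg_le n2); [lia | exact D2]. }
      rewrite <- (beta_split i j).
      replace (c + S i + j + 1)%nat with (S c + i + j + 1)%nat by lia.
      replace (c + i + S j + 1)%nat with (S c + i + j + 1)%nat by lia. ring.
  - intros c i j.
    replace (fun x y => (x + y) ^ c * (1 - (x + y)) ^ S d * xymon i j x y)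
        with (fun x y => (x + y) ^ c * (1 - (x + y)) ^ d * xymon i j x y
                       - (x + y) ^ S c * (1 - (x + y)) ^ d * xymon i j x y)
        by (apply fn_ext; intros; simpl; ring).
    destruct (D c d i j) as [n1 D1]. destruct (D (S c) d i j) as [n2 D2].
    rewrite (integral_sub (n1 + n2)), !IHd.
    2: { apply (dg_le n1); [lia | exact D1]. }
    2: { apply (dg_le n2); [lia | exact D2]. }
    rewrite <- (beta_split (c + i + j + 1) d).
    replace (S c + i + j + 1)%nat with (S (c + i + j + 1)) by lia. ring.
Qed.

(** * Leading terms and orthogonality of the Jacobi basis *)

Lemma binR_pos n k : 0 < binR n k.
Proof.
  unfold binR. apply Rdiv_lt_0_compat; [|apply Rmult_lt_0_compat]; apply INR_fact_pos.
Qed.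

Lemma binR_0_r n : binR n 0 = 1.
Proof.
  unfold binR. rewrite Nat.sub_0_r. simpl (fact 0). change (INR 1) with 1.
  field. apply INR_fact_neq_0.
Qed.

Lemma binR_diag n : binR n n = 1.
Proof.
  unfold binR. rewrite Nat.sub_diag. simpl (fact 0). change (INR 1) with 1.
  field. apply INR_fact_neq_0.
Qed.

Lemma binR_sym n k : (k <= n)%nat -> binR n (n - k) = binR n k.
Proof.
  intros H. unfold binR. replace (n - (n - k))%nat with k by lia. f_equal. ring.
Qed.

Lemma binR_pascal n i : (i < n)%nat -> binR (S n) (S i) = binR n i + binR n (S i).
Proof. intros H. symmetry. exact (pascal n i H). Qed.

(** Pascal's rule and summation by parts: an iterated difference of [f] is the iterated difference,
    one order lower, of the first difference of [f]. *)
Lemma alternating_binR_step m (f : nat -> R) :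
  sumlt (S (S m)) (fun p => (-1) ^ p * binR (S m) p * f p)
  = sumlt (S m) (fun p => (-1) ^ p * binR m p * (f p - f (S p))).
Proof.
  rewrite (sumlt_ext (S m) (fun p => (-1) ^ p * binR m p * (f p - f (S p)))
    (fun p => (-1) ^ p * binR m p * f p + (-1) ^ S p * binR m p * f (S p)))
    by (intros; simpl; ring).
  rewrite sumlt_plus, (sumlt_first (S m)),
    (sumlt_S m (fun p => (-1) ^ S p * binR (S m) (S p) * f (S p))),
    (sumlt_first m (fun p => (-1) ^ p * binR m p * f p)),
    (sumlt_S m (fun p => (-1) ^ S p * binR m p * f (S p))).
  rewrite !binR_0_r, !binR_diag.
  rewrite (sumlt_ext m (fun p => (-1) ^ S p * binR (S m) (S p) * f (S p))
    (fun p => (-1) ^ S p * binR m (S p) * f (S p) + (-1) ^ S p * binR m p * f (S p)))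
    by (intros; rewrite binR_pascal by lia; ring).
  rewrite sumlt_plus. ring.
Qed.

(* The m-th difference of a polynomial of degree e in p. *)
Lemma alternating_binR_sum m e N : (m <= N)%nat -> (e <= m)%nat ->
  sumlt (S m) (fun p => (-1) ^ p * binR m p * binR (N + e - p) e)
  = if Nat.eq_dec e m then 1 else 0.
Proof.
  revert e. induction m as [|m IH]; intros e HN He.
  - replace e with 0%nat by lia. unfold sumlt. simpl. rewrite !binR_0_r. ring.
  - rewrite alternating_binR_step. destruct e as [|e].
    + apply sumlt_zero. intros. rewrite !binR_0_r. ring.
    + rewrite (sumlt_ext _ _ (fun p => (-1) ^ p * binR m p * binR (N + e - p) e)).
      * rewrite IH by lia. destruct (Nat.eq_dec e m), (Nat.eq_dec (S e) (S m)); auto; lia.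
      * intros p Hp. replace (N + S e - p)%nat with (S (N + e - p)) by lia.
        replace (N + S e - S p)%nat with (N + e - p)%nat by lia.
        rewrite binR_pascal by lia. ring.
Qed.

(* The integral of [P_m^{(0,b)}(2 t - 1) t^(b + e)] over [0,1]. *)
Definition jacobi_moment (m b e : nat) : R :=
  sumlt (S m) (fun p => (-1) ^ p * binR (m + 0) (m - p) * binR (m + b) p
                        * beta (m - p + b + e) p).

(** After cancelling factorials each summand is [beta (m + b) e] times [(-1)^p * binR m p * binR (m
    + b + e - p) e]. The last factor is a polynomial of degree [e] in [p], so its difference of
    order [m] vanishes for [e < m] and is 1 for [e = m]. *)
Lemma jacobi_moment_eq m b e : (e <= m)%nat ->
  jacobi_moment m b e
  = if Nat.eq_dec e m then beta (m + b) e else 0.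
Proof.
  intros He. unfold jacobi_moment.
  rewrite (sumlt_ext _ _
    (fun p => beta (m + b) e * ((-1) ^ p * binR m p * binR (m + b + e - p) e))).
  - rewrite sumlt_scal, alternating_binR_sum by lia.
    destruct (Nat.eq_dec e m); ring.
  - intros p Hp. rewrite Nat.add_0_r, binR_sym by lia. unfold binR, beta.
    replace (m + b + e - p - e)%nat with (m + b - p)%nat by lia.
    replace (m - p + b + e + p + 1)%nat with (m + b + e + 1)%nat by lia.
    replace (m + b + e - p)%nat with (m - p + b + e)%nat by lia.
    field. repeat split; apply INR_fact_neq_0.
Qed.

Lemma jacobi_moment_zero m b e : (e < m)%nat -> jacobi_moment m b e = 0.
Proof. intros H. rewrite jacobi_moment_eq by lia. destruct (Nat.eq_dec e m); [lia | auto]. Qed.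

Lemma jacobi_moment_pos m b : 0 < jacobi_moment m b m.
Proof.
  rewrite jacobi_moment_eq by lia. destruct (Nat.eq_dec m m); [|lia].
  unfold beta. apply Rdiv_lt_0_compat; [apply Rmult_lt_0_compat|]; apply INR_fact_pos.
Qed.

Lemma sumlt_mul a b f g :
  sumlt a f * sumlt b g = sumlt a (fun p => sumlt b (fun q => f p * g q)).
Proof.
  rewrite Rmult_comm, <- sumlt_scal. apply sumlt_ext. intros.
  now rewrite sumlt_scal, Rmult_comm.
Qed.

(** In the coordinates [s = x + y] and [x / s] both [bnk n k] and [mon c i] are products, so the
    integral splits into a Legendre moment and a moment of the Jacobi factor in [s]. *)
Lemma integral_bnk_mon n k c i : (k <= n)%nat ->
  integral (fun x y => bnk n k x y * mon c i x y)
  = jacobi_moment k 0 i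
    * sumlt (S (n - k)) (fun p => (-1) ^ p * binR (n - k + 0) (n - k - p)
        * binR (n - k + (2 * k + 1)) p * beta (n - p + c + i + 1) p).
Proof.
  intros Hk. rewrite Rmult_comm. unfold jacobi_moment. rewrite sumlt_mul.
  set (al := fun p => binR (n - k + 0) (n - k - p) * binR (n - k + (2 * k + 1)) p).
  set (ga := fun q => binR (k + 0) (k - q) * binR (k + 0) q).
  (* In the explicit formulas [(t - 1)/2] and [(t + 1)/2] become [-(1 - s)] and [s] for the Jacobi
     factor, [-y] and [x] for the Legendre factor. Hence every term of the product has the form
     covered by [integral_prod]. *)
  set (T := fun p q x y => (x + y) ^ (n - k - p + c) * (1 - (x + y)) ^ p
                           * xymon (k - q + i) q x y).
  replace (fun x y => bnk n k x y * mon c i x y) with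
    (fun x y => sumlt (S (n - k)) (fun p => sumlt (S k) (fun q =>
       (-1) ^ p * (-1) ^ q * al p * ga q * T p q x y))).
  2: { apply fn_ext. intros x y. unfold bnk, jacobi, jacobi_hom.
       rewrite sumlt_mul, Rmult_comm, <- sumlt_scal. apply sumlt_ext. intros p Hp.
       rewrite <- sumlt_scal. apply sumlt_ext. intros q Hq.
       unfold al, ga, T, xymon, mon.
       replace ((2 * (x + y) - 1 - 1) / 2) with (-1 * (1 - (x + y))) by field.
       replace ((2 * (x + y) - 1 + 1) / 2) with (x + y) by field.
       replace ((x - y - (x + y)) / 2) with (-1 * y) by field.
       replace ((x - y + (x + y)) / 2) with x by field.
       rewrite !Rpow_mult_distr, !pow_add. ring. }
  assert (D : forall p q, (p < S (n - k))%nat -> (q < S k)%nat ->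
    dg (S (n + c + i)) (T p q)).
  { intros p q Hp Hq.
    assert (H1 := dg_pow 1 (n - k - p + c) _ dg_s).
    assert (H2 := dg_pow 1 p _ (span_minus _ _ _ (dg_const 1 1) dg_s)).
    assert (H3 : dg (S (k + i)) (xymon (k - q + i) q)).
    { apply dgxy_dg, span_gen. exists (k - q + i)%nat, q. split; [lia | reflexivity]. }
    assert (H12 := dg_mul _ _ _ _ H1 H2). rewrite <- plus_n_Sm in H12.
    eapply dg_le; [|exact (dg_mul _ _ _ _ H12 H3)]. lia. }
  rewrite (integral_sum (S (n + c + i)) _ (fun p x y => sumlt (S k) (fun q =>
       (-1) ^ p * (-1) ^ q * al p * ga q * T p q x y))).
  2: { intros p Hp. exact (span_sum _ _ _ (fun q Hq => span_scal _ _ _ (D p q Hp Hq))). }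
  apply sumlt_ext. intros p Hp.
  rewrite (integral_sum (S (n + c + i)) _ (fun q x y =>
       (-1) ^ p * (-1) ^ q * al p * ga q * T p q x y)) by (intros; now apply span_scal, D).
  apply sumlt_ext. intros q Hq.
  assert (E : integral (T p q) = beta (k - q + i) q * beta (n - p + c + i + 1) p).
  { unfold T. rewrite integral_prod.
    now replace (n - k - p + c + (k - q + i) + q + 1)%nat with (n - p + c + i + 1)%nat by lia. }
  rewrite (integral_scal _ _ _ (D p q Hp Hq)), E. unfold al, ga.
  replace (k - q + 0 + i)%nat with (k - q + i)%nat by lia. ring.
Qed.

(* Monomials preceding [mon c k] in the graded order where [x + y] is smaller than [x]. *)
Definition below (c k : nat) : fn -> Prop :=
  span (fun f => exists c' i, (c' + i < c + k \/ c' + i = c + k /\ i < k)%nat /\ f = mon c' i).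

(** The coefficient [a] is explicit and may vanish, so leading coefficients add and multiply without
    side conditions. *)
Definition lead (c k : nat) (a : R) (f : fn) : Prop :=
  below c k (fun x y => f x y - a * mon c k x y).

Lemma below_mon c k c' i :
  (c' + i < c + k \/ c' + i = c + k /\ i < k)%nat -> below c k (mon c' i).
Proof. intros H. apply span_gen. eauto. Qed.

Lemma below_dg c k f : below c k f -> dg (S (c + k)) f.
Proof. apply span_sub. intros g (c' & i & H & ->). apply dg_mon. lia. Qed.

Lemma dg_below c k f : dg (c + k) f -> below c k f.
Proof. apply span_sub. intros g (c' & i & H & ->). apply below_mon. lia. Qed.

Lemma lead_dg c k a f : lead c k a f -> dg (S (c + k)) f.
Proof.
  intros H. eapply span_ext.
  - exact (span_add _ _ _ (below_dg _ _ _ H)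
             (span_scal _ a _ (dg_mon (S (c + k)) c k ltac:(lia)))).
  - intros. simpl. ring.
Qed.

Lemma lead_ext c k a f g : lead c k a f -> (forall x y, f x y = g x y) -> lead c k a g.
Proof. intros H E. rewrite <- (fn_ext f g); auto. Qed.

(** With leading terms [a m] and [a' m'], the difference [f f' - a a' m m'] equals [(f - a m)(f' -
    a' m') + a' (f - a m) m' + a m (f' - a' m')]. All three products are below [m m'] because the
    order is compatible with multiplication. *)
Lemma lead_mul c k a f c' k' a' f' :
  lead c k a f -> lead c' k' a' f' ->
  lead (c + c') (k + k') (a * a') (fun x y => f x y * f' x y).
Proof.
  intros H H'.
  assert (Hmon : forall c k c' i, mon (c + c') (k + i) = fun x y => mon c k x y * mon c' i x y).
  { intros. apply fn_ext. intros. unfold mon. rewrite !pow_add. ring. }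
  assert (Hm : forall c k, span (eq (mon c k)) (mon c k)) by (intros; now apply span_gen).
  assert (H1 : below (c + c') (k + k')
    (fun x y => (f x y - a * mon c k x y) * (f' x y - a' * mon c' k' x y))).
  { refine (span_mul _ _ _ _ _ _ H H').
    intros u v (p & q & Hpq & ->) (p' & q' & Hpq' & ->). rewrite <- Hmon.
    apply below_mon. lia. }
  assert (H2 : below (c + c') (k + k')
    (fun x y => (f x y - a * mon c k x y) * mon c' k' x y)).
  { refine (span_mul _ _ _ _ _ _ H (Hm c' k')).
    intros u v (p & q & Hpq & ->) <-. rewrite <- Hmon. apply below_mon. lia. }
  assert (H3 : below (c + c') (k + k')
    (fun x y => mon c k x y * (f' x y - a' * mon c' k' x y))).
  { refine (span_mul _ _ _ _ _ _ (Hm c k) H').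
    intros u v <- (p & q & Hpq & ->). rewrite <- Hmon. apply below_mon. lia. }
  eapply span_ext.
  - exact (span_add _ _ _ H1 (span_add _ _ _ (span_scal _ a' _ H2) (span_scal _ a _ H3))).
  - intros. simpl. rewrite (Hmon c k c' k'). ring.
Qed.

Lemma lead_pow c k a f p : lead c k a f -> lead (p * c) (p * k) (a ^ p) (fun x y => f x y ^ p).
Proof.
  intros H. induction p as [|p IH]; [|exact (lead_mul _ _ _ _ _ _ _ _ H IH)].
  eapply span_ext; [apply span_0 | intros; unfold mon; simpl; ring].
Qed.

Lemma lead_sum c k d (a : nat -> R) (f : nat -> fn) :
  (forall p, (p < d)%nat -> lead c k (a p) (f p)) ->
  lead c k (sumlt d a) (fun x y => sumlt d (fun p => f p x y)).
Proof.
  intros H. eapply span_ext.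
  - apply (span_sum _ d (fun p x y => f p x y - a p * mon c k x y)). exact H.
  - intros x y. simpl.
    rewrite (sumlt_ext _ _ (fun p => f p x y + - mon c k x y * a p)) by (intros; ring).
    rewrite sumlt_plus, sumlt_scal. ring.
Qed.

Lemma lead_scal c k a b f : lead c k a f -> lead c k (b * a) (fun x y => b * f x y).
Proof.
  intros H. eapply span_ext; [exact (span_scal _ b _ H) | intros; simpl; ring].
Qed.

(** No cancellation occurs: [s - 1] leads with [s], and [-y = x - s] leads with [x], so all summands
    of either explicit formula share one leading monomial and have positive coefficients. *)
Lemma lead_bnk n k : (k <= n)%nat -> exists a, 0 < a /\ lead (n - k) k a (bnk n k).
Proof.
  intros Hk.
  assert (Hs : lead 1 0 1 (fun x y => x + y)).
  { eapply span_ext; [apply span_0 | intros; unfold mon; simpl; ring]. }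
  assert (Hs1 : lead 1 0 1 (fun x y => x + y - 1)).
  { eapply span_ext; [exact (span_scal _ (-1) _ (below_mon 1 0 0 0 ltac:(lia)))|].
    intros; unfold mon; simpl; ring. }
  assert (Hx : lead 0 1 1 (fun x y => x)).
  { eapply span_ext; [apply span_0 | intros; unfold mon; simpl; ring]. }
  assert (Hy : lead 0 1 1 (fun x y => - y)).
  { eapply span_ext; [exact (span_scal _ (-1) _ (below_mon 0 1 1 0 ltac:(lia)))|].
    intros; unfold mon; simpl; ring. }
  assert (HJ : lead (n - k) 0
    (sumlt (S (n - k)) (fun p => binR (n - k + 0) (n - k - p) * binR (n - k + (2 * k + 1)) p * 1))
    (fun x y => jacobi (n - k) 0 (2 * k + 1) (2 * (x + y) - 1))).
  { apply (lead_sum _ _ _ _ (fun p x y => _)). intros p Hp.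
    eapply lead_ext.
    - apply lead_scal. assert (E := lead_mul _ _ _ _ _ _ _ _
        (lead_pow _ _ _ _ p Hs1) (lead_pow _ _ _ _ (n - k - p) Hs)).
      rewrite !pow1, Rmult_1_r in E.
      replace (p * 1 + (n - k - p) * 1)%nat with (n - k)%nat in E by lia.
      replace (p * 0 + (n - k - p) * 0)%nat with 0%nat in E by lia. exact E.
    - intros. simpl.
      replace ((2 * (x + y) - 1 - 1) / 2) with (x + y - 1) by field.
      replace ((2 * (x + y) - 1 + 1) / 2) with (x + y) by field. ring. }
  assert (HL : lead 0 k
    (sumlt (S k) (fun p => binR (k + 0) (k - p) * binR (k + 0) p * 1))
    (fun x y => jacobi_hom k 0 0 (x - y) (x + y))).
  { apply (lead_sum _ _ _ _ (fun p x y => _)). intros p Hp.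
    eapply lead_ext.
    - apply lead_scal. assert (E := lead_mul _ _ _ _ _ _ _ _
        (lead_pow _ _ _ _ p Hy) (lead_pow _ _ _ _ (k - p) Hx)).
      rewrite !pow1, Rmult_1_r in E.
      replace (p * 1 + (k - p) * 1)%nat with k in E by lia.
      replace (p * 0 + (k - p) * 0)%nat with 0%nat in E by lia. exact E.
    - intros. simpl.
      replace ((x - y - (x + y)) / 2) with (- y) by field.
      replace ((x - y + (x + y)) / 2) with x by field. ring. }
  eexists. split; [|assert (E := lead_mul _ _ _ _ _ _ _ _ HJ HL);
                    rewrite Nat.add_0_r in E; exact E].
  apply Rmult_lt_0_compat; apply sumlt_pos; intros; rewrite Rmult_1_r;
    apply Rmult_lt_0_compat; apply binR_pos.
Qed.

Lemma dg_bnk n k : (k <= n)%nat -> dg (S n) (bnk n k).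
Proof.
  intros H. destruct (lead_bnk n k H) as (a & _ & Ha). apply lead_dg in Ha.
  now replace (n - k + k)%nat with n in Ha by lia.
Qed.

(** For a monomial [mon c i] with [i < k] the Legendre moment vanishes. If [i >= k], then
    [c + i < n], and the Jacobi moment vanishes since [c + i - k < n - k]. *)
Lemma integral_bnk_below n k f : (k <= n)%nat -> below (n - k) k f ->
  integral (fun x y => bnk n k x y * f x y) = 0.
Proof.
  intros Hk Hf.
  assert (Hb := dg_bnk n k Hk).
  assert (D : forall f, below (n - k) k f -> dg (n + S n) (fun x y => bnk n k x y * f x y)).
  { intros g Hg. apply dg_mul; [exact Hb|]. apply below_dg in Hg.
    now replace (n - k + k)%nat with n in Hg by lia. }
  induction Hf as [|f (c & i & H & ->)|f g Hf IHf Hg IHg|a f Hf IHf].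
  - replace (fun x y => bnk n k x y * 0) with (fun _ _ : R => 0)
      by (apply fn_ext; intros; ring). apply integral_0.
  - rewrite integral_bnk_mon by exact Hk.
    destruct (Nat.lt_ge_cases i k) as [Hi|Hi].
    + rewrite jacobi_moment_zero by exact Hi. ring.
    + rewrite (sumlt_ext _ _ (fun p => (-1) ^ p * binR (n - k + 0) (n - k - p)
        * binR (n - k + (2 * k + 1)) p * beta (n - k - p + (2 * k + 1) + (c + i - k)) p))
        by (intros p Hp; do 2 f_equal; lia).
      fold (jacobi_moment (n - k) (2 * k + 1) (c + i - k)).
      rewrite (jacobi_moment_zero (n - k)) by lia. ring.
  - replace (fun x y => bnk n k x y * (f x y + g x y))
      with (fun x y => bnk n k x y * f x y + bnk n k x y * g x y)
      by (apply fn_ext; intros; ring).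
    rewrite (integral_add (n + S n)), IHf, IHg; auto. ring.
  - replace (fun x y => bnk n k x y * (a * f x y))
      with (fun x y => a * (bnk n k x y * f x y))
      by (apply fn_ext; intros; ring).
    rewrite (integral_scal (n + S n)), IHf; auto. ring.
Qed.

Lemma integral_bnk_mon_pos n k : (k <= n)%nat ->
  0 < integral (fun x y => bnk n k x y * mon (n - k) k x y).
Proof.
  intros Hk. rewrite integral_bnk_mon by exact Hk.
  rewrite (sumlt_ext _ _ (fun p => (-1) ^ p * binR (n - k + 0) (n - k - p)
        * binR (n - k + (2 * k + 1)) p * beta (n - k - p + (2 * k + 1) + (n - k)) p))
        by (intros p Hp; do 2 f_equal; lia).
  fold (jacobi_moment (n - k) (2 * k + 1) (n - k)).
  apply Rmult_lt_0_compat; apply jacobi_moment_pos.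
Qed.

Lemma integral_bnk_lead n k a f : (k <= n)%nat -> lead (n - k) k a f ->
  integral (fun x y => bnk n k x y * f x y)
  = a * integral (fun x y => bnk n k x y * mon (n - k) k x y).
Proof.
  intros Hk Hf. assert (Hb := dg_bnk n k Hk).
  replace (fun x y => bnk n k x y * f x y) with
    (fun x y => bnk n k x y * (f x y - a * mon (n - k) k x y)
                + a * (bnk n k x y * mon (n - k) k x y))
    by (apply fn_ext; intros; ring).
  assert (D : dg (n + S n) (fun x y => bnk n k x y * mon (n - k) k x y)).
  { apply dg_mul; [exact Hb | apply dg_mon; lia]. }
  rewrite (integral_add (n + S n)), (integral_scal (n + S n)), integral_bnk_below; auto.
  - ring.
  - apply dg_mul; [exact Hb|]. apply below_dg in Hf.
    now replace (n - k + k)%nat with n in Hf by lia.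
  - now apply span_scal.
Qed.

Lemma integral_bnk_low n k f : (k <= n)%nat -> dg n f ->
  integral (fun x y => bnk n k x y * f x y) = 0.
Proof.
  intros Hk Hf. apply integral_bnk_below; [exact Hk|]. apply dg_below.
  now replace (n - k + k)%nat with n by lia.
Qed.

Lemma integral_bnk_sqr_pos n k : (k <= n)%nat ->
  0 < integral (fun x y => bnk n k x y * bnk n k x y).
Proof.
  intros Hk. destruct (lead_bnk n k Hk) as (a & Ha & Hl).
  rewrite (integral_bnk_lead n k a) by auto.
  apply Rmult_lt_0_compat; [exact Ha | now apply integral_bnk_mon_pos].
Qed.

Lemma integral_bnk_orth n j k : (j <= n)%nat -> (k <= n)%nat -> j <> k ->
  integral (fun x y => bnk n j x y * bnk n k x y) = 0.
Proof.
  intros Hj Hk Hjk.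
  assert (H : forall j k, (j < k)%nat -> (k <= n)%nat ->
    integral (fun x y => bnk n k x y * bnk n j x y) = 0).
  { clear. intros j k Hjk Hk. apply integral_bnk_below; [exact Hk|].
    (* For [j < k] the leading monomial of [bnk n j] already precedes that of [bnk n k]. *)
    destruct (lead_bnk n j ltac:(lia)) as (a & _ & Hl).
    apply (span_ext _ (fun x y => (bnk n j x y - a * mon (n - j) j x y)
                                  + a * mon (n - j) j x y)); [|intros; ring].
    apply span_add.
    - revert Hl. apply span_sub. intros g (c & i & Hci & ->). apply below_mon. lia.
    - apply span_scal, below_mon. lia. }
  destruct (Nat.lt_gt_cases j k) as [[L|L] _]; [exact Hjk | |].
  - replace (fun x y => bnk n j x y * bnk n k x y)
      with (fun x y => bnk n k x y * bnk n j x y) by (apply fn_ext; intros; ring).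
    now apply H.
  - now apply H.
Qed.

(** * The orthogonal complement of lower degrees *)

(** For [n = 0] the orthogonality condition is void because [dg 0] is the zero space; one formula
    thus covers both cases of [Pperp]. *)
Definition perp (n : nat) (p : fn) : Prop :=
  dg (S n) p /\ forall q, dg n q -> integral (fun x y => p x y * q x y) = 0.

Lemma dg_zero f : dg 0 f -> forall x y, f x y = 0.
Proof.
  induction 1 as [|f (c & i & H & _)|f g _ Hf _ Hg|a f _ Hf]; intros x y.
  - reflexivity.
  - lia.
  - rewrite Hf, Hg. ring.
  - rewrite Hf. ring.
Qed.

Lemma Pperp_perp n p : Pperp n p <-> perp n p.
Proof.
  unfold Pperp, perp. rewrite Pspace_dg. split; intros [Hp H]; split; auto.
  - intros q Hq. destruct n as [|n].
    + replace (fun x y => p x y * q x y) with (fun _ _ : R => 0); [apply integral_0|].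
      apply fn_ext. intros. rewrite (dg_zero q Hq). ring.
    + apply H; [lia|]. apply Pspace_dg. now replace (S (S n - 1)) with (S n) by lia.
  - intros Hn q Hq. apply H. apply Pspace_dg in Hq. now replace (S (n - 1)) with n in Hq by lia.
Qed.

Lemma dg_prod a b f g : dg a f -> dg b g -> dg (a + b) (fun x y => f x y * g x y).
Proof. intros Hf. apply dg_mul. revert Hf. apply dg_le. lia. Qed.

Lemma integral_mul_add a b f g h : dg a f -> dg b g -> dg b h ->
  integral (fun x y => f x y * (g x y + h x y))
  = integral (fun x y => f x y * g x y) + integral (fun x y => f x y * h x y).
Proof.
  intros Hf Hg Hh. rewrite <- (integral_add (a + b)) by now apply dg_prod.
  f_equal. apply fn_ext. intros. ring.
Qed.

Lemma integral_mul_scal a b t f g : dg a f -> dg b g ->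
  integral (fun x y => f x y * (t * g x y)) = t * integral (fun x y => f x y * g x y).
Proof.
  intros Hf Hg. rewrite <- (integral_scal (a + b)) by now apply dg_prod.
  f_equal. apply fn_ext. intros. ring.
Qed.

Lemma integral_mul_sum a b d (t : nat -> R) f (g : nat -> fn) :
  dg a f -> (forall k, (k < d)%nat -> dg b (g k)) ->
  integral (fun x y => f x y * sumlt d (fun k => t k * g k x y))
  = sumlt d (fun k => t k * integral (fun x y => f x y * g k x y)).
Proof.
  intros Hf Hg.
  replace (fun x y => f x y * sumlt d (fun k => t k * g k x y))
    with (fun x y => sumlt d (fun k => f x y * (t k * g k x y)))
    by (apply fn_ext; intros; apply sumlt_scal).
  rewrite (integral_sum (a + b) d (fun k x y => f x y * (t k * g k x y)))
    by (intros; apply dg_prod; [exact Hf | now apply span_scal, Hg]).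
  apply sumlt_ext. intros. now apply (integral_mul_scal a b); [|apply Hg].
Qed.

Lemma integral_mul_comm f g :
  integral (fun x y => f x y * g x y) = integral (fun x y => g x y * f x y).
Proof. f_equal. apply fn_ext. intros. ring. Qed.

(** * Orthogonal projection onto the span of the Jacobi basis *)

Definition coef (n k : nat) (f : fn) : R :=
  integral (fun x y => bnk n k x y * f x y)
  / integral (fun x y => bnk n k x y * bnk n k x y).

Definition proj (n : nat) (f : fn) : fn :=
  fun x y => sumlt (S n) (fun k => coef n k f * bnk n k x y).

Lemma perp_bnk n k : (k <= n)%nat -> perp n (bnk n k).
Proof.
  intros Hk. split; [now apply dg_bnk | intros q Hq; now apply integral_bnk_low].
Qed.

Lemma perp_0 n : perp n (fun _ _ => 0).
Proof.
  split; [apply span_0 | intros q Hq].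
  transitivity (integral (fun _ _ => 0)); [|apply integral_0].
  f_equal. apply fn_ext. intros. ring.
Qed.

Lemma perp_add n f g : perp n f -> perp n g -> perp n (fun x y => f x y + g x y).
Proof.
  intros [Hf Hf'] [Hg Hg']. split; [now apply span_add | intros q Hq].
  rewrite integral_mul_comm, (integral_mul_add n (S n)) by assumption.
  rewrite (integral_mul_comm q f), (integral_mul_comm q g), Hf', Hg' by assumption. ring.
Qed.

Lemma perp_scal n a f : perp n f -> perp n (fun x y => a * f x y).
Proof.
  intros [Hf Hf']. split; [now apply span_scal | intros q Hq].
  rewrite integral_mul_comm, (integral_mul_scal n (S n)) by assumption.
  rewrite (integral_mul_comm q f), Hf' by assumption. ring.
Qed.

Lemma perp_sum n d (t : nat -> R) (f : nat -> fn) : (forall k, (k < d)%nat -> perp n (f k)) ->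
  perp n (fun x y => sumlt d (fun k => t k * f k x y)).
Proof.
  intros H. induction d as [|d IH]; [apply perp_0|].
  replace (fun x y => sumlt (S d) (fun k => t k * f k x y))
    with (fun x y => sumlt d (fun k => t k * f k x y) + t d * f d x y)
    by (apply fn_ext; intros; now rewrite sumlt_S).
  apply (perp_add n (fun x y => sumlt d (fun k => t k * f k x y))).
  - apply IH. auto.
  - apply perp_scal, H. lia.
Qed.

Lemma perp_sub n f g : perp n f -> perp n g -> perp n (fun x y => f x y - g x y).
Proof.
  intros Hf Hg. replace (fun x y => f x y - g x y) with (fun x y => f x y + -1 * g x y)
    by (apply fn_ext; intros; ring).
  apply (perp_add n f); [exact Hf | now apply perp_scal].
Qed.

Lemma perp_proj n f : perp n (proj n f).
Proof. apply perp_sum. intros. apply perp_bnk. lia. Qed.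

Lemma coef_low n k f : (k <= n)%nat -> dg n f -> coef n k f = 0.
Proof. intros Hk Hf. unfold coef. rewrite integral_bnk_low by assumption. unfold Rdiv. ring. Qed.

Lemma proj_low n f : dg n f -> forall x y, proj n f x y = 0.
Proof.
  intros Hf x y. apply sumlt_zero. intros. rewrite coef_low by (assumption || lia). ring.
Qed.

Lemma proj_bnk n k : (k <= n)%nat -> forall x y, proj n (bnk n k) x y = bnk n k x y.
Proof.
  intros Hk x y. unfold proj. assert (Hp := integral_bnk_sqr_pos n k Hk).
  rewrite (sumlt_single _ k); [| lia |].
  - unfold coef. field. lra.
  - intros j Hj Hjk. unfold coef. rewrite integral_bnk_orth by lia. unfold Rdiv. ring.
Qed.

Lemma proj_add n f g : dg (S n) f -> dg (S n) g ->
  forall x y, proj n (fun x y => f x y + g x y) x y = proj n f x y + proj n g x y.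
Proof.
  intros Hf Hg x y. unfold proj. rewrite <- sumlt_plus. apply sumlt_ext. intros k Hk.
  unfold coef. rewrite (integral_mul_add (S n) (S n)) by (assumption || (apply dg_bnk; lia)).
  unfold Rdiv. ring.
Qed.

Lemma proj_scal n a f : dg (S n) f ->
  forall x y, proj n (fun x y => a * f x y) x y = a * proj n f x y.
Proof.
  intros Hf x y. unfold proj. rewrite <- sumlt_scal. apply sumlt_ext. intros k Hk.
  unfold coef. rewrite (integral_mul_scal (S n) (S n)) by (assumption || (apply dg_bnk; lia)).
  unfold Rdiv. ring.
Qed.

(** The functions satisfying the claim form a linear space [D] containing all lower degrees and
    every [bnk n i]. The monomials of degree [n] enter it by induction on [i], since [bnk n i]
    expresses its leading monomial through preceding ones. *)
Lemma dg_sub_proj n f : dg (S n) f -> dg n (fun x y => f x y - proj n f x y).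
Proof.
  set (D := fun f => dg (S n) f /\ dg n (fun x y => f x y - proj n f x y)).
  assert (Dlow : forall f, dg n f -> D f).
  { intros g Hg. split; [eapply dg_le; [|exact Hg]; lia|].
    apply (span_ext _ g); [exact Hg | intros; rewrite proj_low by exact Hg; ring]. }
  assert (Dadd : forall f g, D f -> D g -> D (fun x y => f x y + g x y)).
  { intros u v [Hu Hu'] [Hv Hv']. split; [now apply span_add|].
    eapply span_ext; [exact (span_add _ _ _ Hu' Hv')|].
    intros. simpl. rewrite proj_add by assumption. ring. }
  assert (Dscal : forall a f, D f -> D (fun x y => a * f x y)).
  { intros a u [Hu Hu']. split; [now apply span_scal|].
    eapply span_ext; [exact (span_scal _ a _ Hu')|].
    intros. simpl. rewrite proj_scal by assumption. ring. }
  assert (Dspan : forall f, span D f -> D f).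
  { induction 1; auto. apply Dlow, span_0. }
  assert (Dmon : forall i, (i <= n)%nat -> D (mon (n - i) i)).
  { induction i as [i IH] using (well_founded_induction lt_wf). intros Hi.
    destruct (lead_bnk n i Hi) as (a & Ha & Hl).
    assert (Db : D (bnk n i)).
    { split; [now apply dg_bnk|].
      apply (span_ext _ (fun _ _ => 0)); [apply span_0|].
      intros. rewrite proj_bnk by exact Hi. ring. }
    assert (Dr : D (fun x y => bnk n i x y - a * mon (n - i) i x y)).
    { apply Dspan. revert Hl. apply span_sub. intros g (c & j & Hcj & ->).
      apply span_gen. destruct (Nat.lt_ge_cases (c + j) n) as [L|L].
      - now apply Dlow, dg_mon.
      - replace c with (n - j)%nat by lia. apply IH; lia. }
    replace (mon (n - i) i) with
      (fun x y => / a * (bnk n i x y + -1 * (bnk n i x y - a * mon (n - i) i x y)))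
      by (apply fn_ext; intros; field; lra).
    apply Dscal. apply Dadd; [exact Db | now apply Dscal]. }
  intros Hf. apply Dspan. revert Hf. apply span_sub. intros g (c & i & Hci & ->).
  apply span_gen. destruct (Nat.lt_ge_cases (c + i) n) as [L|L].
  - now apply Dlow, dg_mon.
  - replace c with (n - i)%nat by lia. apply Dmon. lia.
Qed.

(** Descent on the degree: orthogonality to the top Jacobi functions makes the projection of [g]
    zero, so [g] has lower degree. *)
Lemma integral_nondegenerate n g : dg n g ->
  (forall q, dg n q -> integral (fun x y => g x y * q x y) = 0) -> forall x y, g x y = 0.
Proof.
  induction n as [|n IH]; intros Hg H; [now apply dg_zero|].
  assert (Hz : forall x y, proj n g x y = 0).
  { intros. apply sumlt_zero. intros k Hk. unfold coef.
    rewrite integral_mul_comm, H by (apply dg_bnk; lia). unfold Rdiv. ring. }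
  apply IH.
  - eapply span_ext; [exact (dg_sub_proj n g Hg) | intros; simpl; rewrite Hz; ring].
  - intros q Hq. apply H. revert Hq. apply dg_le. lia.
Qed.

(** The integral sees only the triangle, so the difference is orthogonal to every polynomial and
    hence vanishes on the whole plane. *)
Lemma dg_eq_T n f g : dg n f -> dg n g -> (forall x y, inT x y -> f x y = g x y) ->
  forall x y, f x y = g x y.
Proof.
  intros Hf Hg H x y. apply Rminus_diag_uniq.
  apply (integral_nondegenerate n (fun x y => f x y - g x y)); [now apply span_minus|].
  intros q _. transitivity (integral (fun _ _ => 0)); [|apply integral_0].
  apply integral_ext_T.
  intros u v Huv. rewrite H by exact Huv. ring.
Qed.

Lemma perp_expansion n p : perp n p -> forall x y, p x y = proj n p x y.
Proof.
  intros [Hp H] x y. apply Rminus_diag_uniq.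
  apply (integral_nondegenerate n (fun x y => p x y - proj n p x y)).
  - now apply dg_sub_proj.
  - now apply (perp_sub n p (proj n p)); [split | apply perp_proj].
Qed.

(** Parseval: the integral of [p^2] is the sum of the squared coefficients weighted by the positive
    square norms of the [bnk n k]. *)
Lemma perp_sqr_zero n p : perp n p -> integral (fun x y => p x y * p x y) = 0 ->
  forall x y, p x y = 0.
Proof.
  intros Hp H x y.
  assert (E : integral (fun x y => p x y * p x y)
    = sumlt (S n) (fun k => coef n k p * integral (fun x y => p x y * bnk n k x y))).
  { rewrite <- (integral_mul_sum (S n) (S n)); [| apply Hp | intros; apply dg_bnk; lia].
    f_equal. apply fn_ext. intros u v. f_equal. now apply perp_expansion. }
  rewrite (perp_expansion n p Hp). apply sumlt_zero. intros k Hk.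
  rewrite H in E. symmetry in E.
  assert (T : forall k, (k < S n)%nat -> coef n k p * integral (fun x y => p x y * bnk n k x y)
    = coef n k p ^ 2 * integral (fun x y => bnk n k x y * bnk n k x y)).
  { intros j Hj. rewrite integral_mul_comm. unfold coef. field.
    apply Rgt_not_eq, integral_bnk_sqr_pos. lia. }
  assert (Z := sumlt_nonneg_zero _ _ (fun j Hj => ltac:(rewrite T by exact Hj;
    apply Rmult_le_pos; [apply pow2_ge_0 | apply Rlt_le, integral_bnk_sqr_pos; lia])) E k Hk).
  simpl in Z. rewrite T in Z by exact Hk.
  assert (Hpos := integral_bnk_sqr_pos n k ltac:(lia)).
  apply Rmult_integral in Z. destruct Z as [Z|Z]; [|lra].
  replace (coef n k p) with 0 by nra. ring.
Qed.

(** * Action of the symmetries on the Jacobi basis, and orbit sums *)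

Lemma perp_swap n p : perp n p -> perp n (swap p).
Proof.
  intros [Hp H]. split; [now apply dg_swap | intros q Hq].
  change (integral (swap (fun x y => p x y * swap q x y)) = 0).
  rewrite (integral_swap (S n + n)) by now apply dg_prod; [|apply dg_swap].
  now apply H, dg_swap.
Qed.

Lemma refl_refl f x y : refl (refl f) x y = f x y.
Proof. unfold refl. f_equal. ring. Qed.

Lemma perp_refl n p : perp n p -> perp n (refl p).
Proof.
  intros [Hp H]. split; [now apply dg_refl | intros q Hq].
  rewrite <- (H (refl q)), <- (integral_refl (S n + n) (fun x y => p x y * refl q x y)).
  - f_equal. apply fn_ext. intros. now rewrite <- (refl_refl q).
  - apply dg_prod; [exact Hp | now apply dg_refl].
  - now apply dg_refl.
Qed.

(** The description is realized by the expansion coefficients of the reflected basis functions,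
    which stay in the orthogonal complement. *)
Lemma Mrel_Mcoef n : Mrel n (Mcoef n).
Proof.
  unfold Mcoef. apply epsilon_spec. exists (fun j k => coef n j (refl (bnk n k))).
  intros k Hk x y.
  transitivity (proj n (refl (bnk n k)) x y).
  - now apply (perp_expansion n (refl (bnk n k))), perp_refl, perp_bnk.
  - apply sumlt_ext. intros. ring.
Qed.

(** The Jacobi factor depends on [x + y] only; the sign is the parity of the Legendre polynomial,
    obtained by reversing its sum. *)
Lemma bnk_swap n k x y : bnk n k y x = (-1) ^ k * bnk n k x y.
Proof.
  unfold bnk. rewrite (Rplus_comm y x).
  enough (E : jacobi_hom k 0 0 (y - x) (x + y)
              = (-1) ^ k * jacobi_hom k 0 0 (x - y) (x + y)) by (rewrite E; ring).
  unfold jacobi_hom. rewrite sumlt_rev, <- sumlt_scal. apply sumlt_ext. intros p Hp.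
  rewrite !Nat.add_0_r. replace (k - (k - p))%nat with p by lia.
  replace ((y - x - (x + y)) / 2) with (-1 * x) by field.
  replace ((y - x + (x + y)) / 2) with y by field.
  replace ((x - y - (x + y)) / 2) with (-1 * y) by field.
  replace ((x - y + (x + y)) / 2) with x by field.
  rewrite !Rpow_mult_distr.
  assert (E : (-1) ^ k = (-1) ^ (k - p) * (-1) ^ p) by (rewrite <- pow_add; f_equal; lia).
  assert (E2 : (-1) ^ p * (-1) ^ p = 1).
  { rewrite <- Rpow_mult_distr. replace (-1 * -1) with 1 by ring. apply pow1. }
  rewrite E. rewrite <- (Rmult_1_r (_ * y ^ p)), <- E2. ring.
Qed.

(* The orbit sum of a function invariant under [swap]: a multiple of its symmetrization. *)
Definition orbit (f : fn) : fn := fun x y => f x y + refl f x y + swap (refl f) x y.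

(** Expand the reflected function in the basis and add its swapped copy: by [bnk_swap] the odd
    indices cancel and the even ones double. *)
Lemma rnk_orbit n m : (2 * m <= n)%nat ->
  forall x y, rnk n (2 * m) x y = orbit (bnk n (2 * m)) x y.
Proof.
  intros Hm x y. unfold rnk, orbit.
  assert (M := Mrel_Mcoef n (2 * m)%nat Hm).
  change (refl (bnk n (2 * m)) x y) with (bnk n (2 * m) (1 - x - y) y).
  change (swap (refl (bnk n (2 * m))) x y) with (bnk n (2 * m) (1 - y - x) x).
  rewrite !M, <- (sumlt_even_part n (fun j => Mcoef n j (2 * m) * bnk n j x y)).
  rewrite Rplus_assoc, <- sumlt_plus, Rplus_comm. f_equal. apply sumlt_ext. intros.
  rewrite (bnk_swap n k x y). ring.
Qed.

Lemma perp_orbit n f : perp n f -> perp n (orbit f).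
Proof.
  intros H. apply (perp_add n (fun x y => f x y + refl f x y)); [apply perp_add|];
    auto using perp_swap, perp_refl.
Qed.

Lemma orbit_swap f : (forall x y, swap f x y = f x y) ->
  forall x y, swap (orbit f) x y = orbit f x y.
Proof.
  intros H x y. change (f y x + refl f y x + refl f x y = f x y + refl f x y + refl f y x).
  rewrite <- (H x y). unfold swap. ring.
Qed.

(** The reflection exchanges the first two terms and, by the invariance of [f] under [swap], fixes
    the third. *)
Lemma orbit_refl f : (forall x y, swap f x y = f x y) ->
  forall x y, refl (orbit f) x y = orbit f x y.
Proof.
  intros H x y. unfold orbit, refl, swap.
  replace (1 - (1 - x - y) - y) with x by ring.
  replace (1 - y - (1 - x - y)) with x by ring.
  rewrite <- (H x (1 - x - y)). unfold swap.
  replace (1 - y - x) with (1 - x - y) by ring. ring.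
Qed.

(** * Symmetric polynomials *)

Definition symmetric (f : fn) : Prop :=
  (forall x y, swap f x y = f x y) /\ (forall x y, refl f x y = f x y).

(** An affine bijection of the triangle permutes its vertices, hence is one of six explicit maps,
    under all of which [f] is invariant. *)
Lemma symmetric_totally f : symmetric f -> totally_symmetric f.
Proof.
  intros [Hs Hr] a b c d e g (Hin & Hsurj & _) x y _.
  assert (P1 : forall x y, f y x = f x y) by exact Hs.
  assert (P2 : forall x y, f (1 - x - y) y = f x y) by exact Hr.
  assert (P3 : forall x y, f y (1 - x - y) = f x y) by (intros; now rewrite P1).
  assert (P4 : forall x y, f (1 - x - y) x = f x y).
  { intros u v. rewrite <- (P1 u v), <- (P2 v u). f_equal. ring. }
  assert (P5 : forall x y, f x (1 - x - y) = f x y) by (intros; now rewrite P1).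
  (* A convex combination of numbers at most 1 equals 1 only if one of them does. Applied to the
     barycentric coordinates of the images of the vertices, it shows that each vertex is the image
     of a vertex. *)
  assert (Hconv : forall x y u v w, inT x y -> u <= 1 -> v <= 1 -> w <= 1 ->
    (1 - x - y) * u + x * v + y * w = 1 -> u = 1 \/ v = 1 \/ w = 1).
  { clear. intros x y u v w (Hx & Hy & Hxy) Hu Hv Hw E.
    destruct (Req_dec u 1), (Req_dec v 1), (Req_dec w 1); try tauto. exfalso.
    assert (0 <= (1 - x - y) * (1 - u)) by (apply Rmult_le_pos; lra).
    assert (0 <= x * (1 - v)) by (apply Rmult_le_pos; lra).
    assert (0 <= y * (1 - w)) by (apply Rmult_le_pos; lra).
    assert (Zx : x * (1 - v) = 0) by lra. assert (Zy : y * (1 - w) = 0) by lra.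
    apply Rmult_integral in Zx, Zy. assert (x = 0) by lra. assert (y = 0) by lra. subst. lra. }
  unfold affine_map in *. simpl in *.
  assert (V0 := Hin 0 0 ltac:(unfold inT; lra)).
  assert (V1 := Hin 1 0 ltac:(unfold inT; lra)).
  assert (V2 := Hin 0 1 ltac:(unfold inT; lra)).
  destruct (Hsurj 1 0 ltac:(unfold inT; lra)) as (x1 & y1 & T1 & E1).
  destruct (Hsurj 0 1 ltac:(unfold inT; lra)) as (x2 & y2 & T2 & E2).
  destruct (Hsurj 0 0 ltac:(unfold inT; lra)) as (x3 & y3 & T3 & E3).
  injection E1 as E1 _. injection E2 as _ E2. injection E3 as E3 E3'.
  unfold inT in V0, V1, V2.
  (* [D1], [D2], [D3] tell which vertex goes to [(1,0)], [(0,1)], [(0,0)]. Of the 27 combinations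
     the six permutations survive, and each determines all six coefficients. *)
  assert (D1 := Hconv x1 y1 e (a + e) (b + e) T1 ltac:(lra) ltac:(lra) ltac:(lra) ltac:(lra)).
  assert (D2 := Hconv x2 y2 g (c + g) (d + g) T2 ltac:(lra) ltac:(lra) ltac:(lra) ltac:(lra)).
  assert (D3 := Hconv x3 y3 (1 - e - g) (1 - a - e - c - g) (1 - b - e - d - g) T3
                  ltac:(lra) ltac:(lra) ltac:(lra) ltac:(lra)).
  clear - P1 P2 P3 P4 P5 V0 V1 V2 D1 D2 D3.
  destruct D1 as [D1|[D1|D1]], D2 as [D2|[D2|D2]]; try (exfalso; lra);
  destruct D3 as [D3|[D3|D3]]; try (exfalso; lra);
  (let det v := (first [assert (v = 0) by lra | assert (v = 1) by lra | assert (v = -1) by lra])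
   in det a; det b; det c; det d; det e; det g); subst;
  first
  [ f_equal; ring
  | rewrite <- (P1 x y); f_equal; ring
  | rewrite <- (P2 x y); f_equal; ring
  | rewrite <- (P3 x y); f_equal; ring
  | rewrite <- (P4 x y); f_equal; ring
  | rewrite <- (P5 x y); f_equal; ring ].
Qed.

Lemma totally_symmetric_inv n f : dg n f -> totally_symmetric f -> symmetric f.
Proof.
  intros Hf H. split; apply (dg_eq_T n); auto using dg_swap, dg_refl; intros x y Hxy.
  - assert (A : affine_bij_T 0 1 1 0 0 0).
    { unfold affine_bij_T, affine_map, inT; simpl. split; [|split].
      - intros; lra.
      - intros u v Huv. exists v, u. split; [lra|]. f_equal; ring.
      - intros u v u' v' _ _ E. injection E. lra. }
    rewrite <- (H _ _ _ _ _ _ A x y Hxy). unfold swap, affine_map. simpl. f_equal; ring.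
  - assert (A : affine_bij_T (-1) (-1) 0 1 1 0).
    { unfold affine_bij_T, affine_map, inT; simpl. split; [|split].
      - intros; lra.
      - intros u v Huv. exists (1 - u - v), v. split; [lra|]. f_equal; ring.
      - intros u v u' v' _ _ E. injection E. lra. }
    rewrite <- (H _ _ _ _ _ _ A x y Hxy). unfold refl, affine_map. simpl. f_equal; ring.
Qed.

(* The elementary symmetric polynomials of the barycentric coordinates. *)
Definition e2 : fn := fun x y => x * y + (x + y) * (1 - (x + y)).
Definition e3 : fn := fun x y => x * y * (1 - x - y).
Definition emon (a b : nat) : fn := fun x y => e2 x y ^ a * e3 x y ^ b.

Lemma emon_symmetric a b : symmetric (emon a b).
Proof.
  split; intros x y; unfold swap, refl, emon, e2, e3; f_equal; f_equal; ring.
Qed.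

(** With [s = x + y] and [x y = s x - x^2], the leading term of [e2] is [-x^2] and that of [e3] is
    [s x^2]. *)
Lemma lead_emon a b : lead b (2 * a + 2 * b) ((-1) ^ a) (emon a b).
Proof.
  assert (H2 : lead 0 2 (-1) e2).
  { eapply span_ext.
    - exact (span_minus _ _ _
        (span_add _ _ _ (below_mon 0 2 1 1 ltac:(lia)) (below_mon 0 2 1 0 ltac:(lia)))
        (below_mon 0 2 2 0 ltac:(lia))).
    - intros; unfold mon, e2; simpl; ring. }
  assert (H3 : lead 1 2 1 e3).
  { eapply span_ext.
    - exact (span_minus _ _ _ (span_minus _ _ _ (below_mon 1 2 1 1 ltac:(lia))
        (below_mon 1 2 0 2 ltac:(lia))) (below_mon 1 2 2 1 ltac:(lia))).
    - intros; unfold mon, e3; simpl; ring. }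
  assert (E := lead_mul _ _ _ _ _ _ _ _ (lead_pow _ _ _ _ a H2) (lead_pow _ _ _ _ b H3)).
  rewrite pow1, Rmult_1_r in E.
  replace (a * 0 + b * 1)%nat with b in E by lia.
  now replace (a * 2 + b * 2)%nat with (2 * a + 2 * b)%nat in E by lia.
Qed.

Lemma dg_emon a b n : (2 * a + 3 * b < n)%nat -> dg n (emon a b).
Proof.
  intros H. eapply dg_le; [|exact (lead_dg _ _ _ _ (lead_emon a b))]. lia.
Qed.

(** * Generation of the symmetric polynomials by [e2] and [e3] *)

Definition emx (a b i j : nat) : fn := fun x y => emon a b x y * (x ^ i * y ^ j).

(* Polynomials are generated over [e2], [e3] by the six monomials [x^i y^j], [i <= 2], [j <= 1]. *)
Definition coinv (n : nat) : fn -> Prop :=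
  span (fun f => exists a b i j,
    (i <= 2 /\ j <= 1 /\ 2 * a + 3 * b + i + j <= n)%nat /\ f = emx a b i j).

Lemma coinv_gen n a b i j : (i <= 2 /\ j <= 1 /\ 2 * a + 3 * b + i + j <= n)%nat ->
  coinv n (emx a b i j).
Proof. intros H. apply span_gen. exists a, b, i, j. auto. Qed.

Lemma coinv_x n f : coinv n f -> coinv (S n) (fun x y => x * f x y).
Proof.
  induction 1 as [|f (a & b & i & j & H & ->)|f g _ Hf _ Hg|t f _ Hf].
  - eapply span_ext; [apply span_0 | intros; simpl; ring].
  - destruct (Nat.eq_dec i 2) as [->|Hi].
    + eapply span_ext.
      (* The barycentric coordinate [x] is a root of [T^3 - T^2 + e2 T - e3], so
         [x^3 = x^2 - e2 x + e3]. *)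
      * exact (span_add _ _ _ (span_minus _ _ _ (coinv_gen (S n) a b 2 j ltac:(lia))
          (coinv_gen (S n) (S a) b 1 j ltac:(lia))) (coinv_gen (S n) a (S b) 0 j ltac:(lia))).
      * intros. unfold emx, emon. simpl.
        generalize (e2 x y ^ a) (e3 x y ^ b) (y ^ j). intros. unfold e2, e3. ring.
    + eapply span_ext; [apply (coinv_gen (S n) a b (S i) j); lia|].
      intros. unfold emx. simpl. ring.
  - eapply span_ext; [exact (span_add _ _ _ Hf Hg) | intros; simpl; ring].
  - eapply span_ext; [exact (span_scal _ t _ Hf) | intros; simpl; ring].
Qed.

Lemma coinv_y n f : coinv n f -> coinv (S n) (fun x y => y * f x y).
Proof.
  induction 1 as [|f (a & b & i & j & H & ->)|f g _ Hf _ Hg|t f _ Hf].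
  - eapply span_ext; [apply span_0 | intros; simpl; ring].
  - destruct (Nat.eq_dec j 1) as [->|Hj].
    + destruct n as [|n]; [lia|].
      assert (H1 := coinv_gen (S n) a b i 1 ltac:(lia)).
      assert (H0 := coinv_gen n a b i 0 ltac:(lia)).
      eapply span_ext.
      (* The reduction is [y^2 = x + y - x y - x^2 - e2]; the products with [x] go through
         [coinv_x], since [i] may already be 2. *)
      * exact (span_minus _ _ _ (span_add _ _ _ (coinv_x _ _ (coinv_gen (S n) a b i 0 ltac:(lia)))
          (coinv_gen (S (S n)) a b i 1 ltac:(lia)))
          (span_add _ _ _ (coinv_x _ _ H1)
            (span_add _ _ _ (coinv_x _ _ (coinv_x _ _ H0))
              (coinv_gen (S (S n)) (S a) b i 0 ltac:(lia))))).
      * intros. unfold emx, emon. simpl.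
        generalize (e2 x y ^ a) (e3 x y ^ b) (x ^ i). intros. unfold e2. ring.
    + eapply span_ext; [apply (coinv_gen (S n) a b i (S j)); lia|].
      intros. unfold emx. simpl. ring.
  - eapply span_ext; [exact (span_add _ _ _ Hf Hg) | intros; simpl; ring].
  - eapply span_ext; [exact (span_scal _ t _ Hf) | intros; simpl; ring].
Qed.

Lemma dg_coinv n f : dg (S n) f -> coinv n f.
Proof.
  intros H. apply dg_dgxy in H. revert H. apply span_sub. intros g (i & j & Hij & ->).
  assert (Hm : forall i j, coinv (i + j) (xymon i j)).
  { clear. induction i as [|i IHi]; [induction j as [|j IHj]|]; try intros j.
    - eapply span_ext; [apply (coinv_gen 0 0 0 0 0); lia|].
      intros; unfold emx, emon, xymon; simpl; ring.
    - eapply span_ext; [exact (coinv_y _ _ IHj) | intros; unfold xymon; simpl; ring].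
    - eapply span_ext; [exact (coinv_x _ _ (IHi j)) | intros; unfold xymon; simpl; ring]. }
  eapply span_sub; [|exact (Hm i j)].
  intros h (a & b & i' & j' & H' & ->). apply coinv_gen. lia.
Qed.

(** A symmetric [p] is one sixth of its sum over the group. That sum leaves the factors [emon a b]
    untouched, so only the six products [x^i y^j] need to be symmetrized. *)
Lemma symmetric_span n p : dg (S n) p -> symmetric p ->
  span (fun f => exists a b, (2 * a + 3 * b <= n)%nat /\ f = emon a b) p.
Proof.
  intros Hp [Hs Hr]. apply dg_coinv in Hp.
  set (S6 := fun f => orbit (fun x y => f x y + swap f x y)).
  assert (HS : forall f, coinv n f ->
    span (fun f => exists a b, (2 * a + 3 * b <= n)%nat /\ f = emon a b) (S6 f)).
  { intros f. unfold S6, orbit, swap, refl.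
    induction 1 as [|f (a & b & i & j & H & ->)|f g _ Hf _ Hg|t f _ Hf].
    - eapply span_ext; [apply span_0 | intros; simpl; ring].
    - assert (G : forall a b, (2 * a + 3 * b <= n)%nat ->
        span (fun f => exists a b, (2 * a + 3 * b <= n)%nat /\ f = emon a b) (emon a b))
        by (intros; apply span_gen; eauto).
      assert (Es : forall x y, emon a b y x = emon a b x y) by apply emon_symmetric.
      assert (Er : forall x y, emon a b (1 - x - y) y = emon a b x y) by apply emon_symmetric.
      assert (E1 : forall x y, emon a b y (1 - x - y) = emon a b x y)
        by (intros u v; now rewrite (Es (1 - u - v) v)).
      assert (E2 : forall x y, emon a b (1 - y - x) x = emon a b x y)
        by (intros u v; now rewrite (Er v u), (Es u v)).
      assert (E3 : forall x y, emon a b x (1 - y - x) = emon a b x y)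
        by (intros u v; now rewrite (Es (1 - v - u) u), (E2 u v)).
      (* The group sums of [1], [y], [x], [x y], [x^2], [x^2 y] are [6], [2], [2], [2 e2],
         [2 - 4 e2], [e2 - 3 e3]. *)
      destruct i as [|[|[|i]]]; [| | |lia]; (destruct j as [|[|j]]; [| |lia]).
      + eapply span_ext; [exact (span_scal _ 6 _ (G a b ltac:(lia)))|].
        intros. unfold emx. rewrite (Es x y), (Er x y), (E1 x y), (E2 x y), (E3 x y). simpl. ring.
      + eapply span_ext; [exact (span_scal _ 2 _ (G a b ltac:(lia)))|].
        intros. unfold emx. rewrite (Es x y), (Er x y), (E1 x y), (E2 x y), (E3 x y). simpl. ring.
      + eapply span_ext; [exact (span_scal _ 2 _ (G a b ltac:(lia)))|].
        intros. unfold emx. rewrite (Es x y), (Er x y), (E1 x y), (E2 x y), (E3 x y). simpl. ring.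
      + eapply span_ext; [exact (span_scal _ 2 _ (G (S a) b ltac:(lia)))|].
        intros. unfold emx. rewrite (Es x y), (Er x y), (E1 x y), (E2 x y), (E3 x y). unfold emon. simpl.
        generalize (e2 x y ^ a) (e3 x y ^ b). intros. unfold e2. ring.
      + eapply span_ext; [exact (span_minus _ _ _ (span_scal _ 2 _ (G a b ltac:(lia)))
          (span_scal _ 4 _ (G (S a) b ltac:(lia))))|].
        intros. unfold emx. rewrite (Es x y), (Er x y), (E1 x y), (E2 x y), (E3 x y). unfold emon. simpl.
        generalize (e2 x y ^ a) (e3 x y ^ b). intros. unfold e2. ring.
      + eapply span_ext; [exact (span_minus _ _ _ (G (S a) b ltac:(lia))
          (span_scal _ 3 _ (G a (S b) ltac:(lia))))|].
        intros. unfold emx. rewrite (Es x y), (Er x y), (E1 x y), (E2 x y), (E3 x y). unfold emon. simpl.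
        generalize (e2 x y ^ a) (e3 x y ^ b). intros. unfold e2, e3. ring.
    - eapply span_ext; [exact (span_add _ _ _ Hf Hg) | intros; simpl; ring].
    - eapply span_ext; [exact (span_scal _ t _ Hf) | intros; simpl; ring]. }
  eapply span_ext; [exact (span_scal _ (/ 6) _ (HS p Hp))|].
  intros x y. unfold S6, orbit, swap, refl.
  assert (Q1 : forall x y, p y x = p x y) by exact Hs.
  assert (Q2 : forall x y, p (1 - x - y) y = p x y) by exact Hr.
  rewrite (Q1 (1 - x - y) y), (Q1 (1 - y - x) x), (Q2 x y), (Q2 y x), (Q1 x y). field.
Qed.

(** By invariance of the integral and of [f], the three terms of the orbit sum contribute
    equally. *)
Lemma integral_symmetric_orbit a b f g : dg a f -> dg b g -> symmetric f ->
  integral (fun x y => f x y * orbit g x y) = 3 * integral (fun x y => f x y * g x y).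
Proof.
  intros Hf Hg [Hs Hr].
  assert (Hr' := dg_refl _ _ Hg). assert (Hrs := dg_swap _ _ Hr').
  unfold orbit.
  assert (Ha := span_add _ _ _ Hg Hr').
  rewrite (integral_mul_add a b f (fun x y => g x y + refl g x y)) by assumption.
  rewrite (integral_mul_add a b) by assumption.
  assert (E1 : integral (fun x y => f x y * refl g x y) = integral (fun x y => f x y * g x y)).
  { rewrite <- (integral_refl (a + b) (fun x y => f x y * g x y)) by now apply dg_prod.
    f_equal. apply fn_ext. intros. now rewrite <- Hr. }
  assert (E2 : integral (fun x y => f x y * swap (refl g) x y)
               = integral (fun x y => f x y * refl g x y)).
  { rewrite <- (integral_swap (a + b) (fun x y => f x y * refl g x y)) by now apply dg_prod.
    f_equal. apply fn_ext. intros. now rewrite <- Hs. }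
  rewrite E2, E1. ring.
Qed.

(* [bsym n k] is [rnk n (2 * half_index n k)]; with [b = n - 2 * half_index n k] and [2 a + 3 b = n],
   its dual partner is the symmetric polynomial [emon a b]. *)
Definition half_index (n k : nat) : nat := (Nat.div n 2 - k)%nat.

Definition dual (n k : nat) : fn :=
  emon (3 * half_index n k - n) (n - 2 * half_index n k).

Ltac Zify.zify_post_hook ::= Z.to_euclidean_division_equations.

(** These bounds make the truncated subtractions in [half_index] and [dual] exact; the exponents in
    [dual] are then genuine and satisfy [2 a + 3 b = n]. *)
Lemma dtriv_index n k : (k < dtriv n)%nat ->
  (n <= 3 * half_index n k /\ 2 * half_index n k <= n /\ k <= Nat.div n 2)%nat.
Proof. unfold dtriv, half_index. lia. Qed.

Lemma dtriv_surj n a b : (2 * a + 3 * b = n)%nat ->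
  exists k, (k < dtriv n)%nat /\ emon a b = dual n k.
Proof.
  (* As [b] and [n] have the same parity, [b = n - 2 (n/2 - k)] with integer division is solved by
     [k = b/2]. *)
  intros H. exists (Nat.div b 2). split.
  - unfold dtriv. lia.
  - unfold dual, half_index. f_equal; lia.
Qed.

(** Both parity cases of [bsym] use the same even index, twice [n/2 - k]. *)
Lemma bsym_orbit n k : (k < dtriv n)%nat ->
  bsym n k = orbit (bnk n (2 * half_index n k)).
Proof.
  intros Hk. apply dtriv_index in Hk. unfold half_index in *.
  apply fn_ext. intros x y. rewrite <- rnk_orbit by lia.
  unfold bsym. destruct (Nat.even n) eqn:E.
  - apply Nat.even_spec in E. destruct E as [m ->]. f_equal. lia.
  - assert (O : Nat.Odd n) by (apply Nat.odd_spec; unfold Nat.odd; now rewrite E).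
    destruct O as [m ->]. f_equal. lia.
Qed.

Lemma bnk_even_swap n m x y : swap (bnk n (2 * m)) x y = bnk n (2 * m) x y.
Proof. unfold swap. rewrite bnk_swap, pow_1_even. ring. Qed.

Lemma bsym_symmetric n k : (k < dtriv n)%nat -> symmetric (bsym n k).
Proof.
  intros Hk. rewrite bsym_orbit by exact Hk.
  split; [apply orbit_swap | apply orbit_refl]; intros; apply bnk_even_swap.
Qed.

Lemma perp_bsym n k : (k < dtriv n)%nat -> perp n (bsym n k).
Proof.
  intros Hk. rewrite bsym_orbit by exact Hk. apply perp_orbit, perp_bnk.
  now apply dtriv_index in Hk.
Qed.

Lemma dual_dg n k : (k < dtriv n)%nat -> dg (S n) (dual n k).
Proof. intros Hk. apply dtriv_index in Hk. apply dg_emon. lia. Qed.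

(** * Triangular pairing of the dual polynomials with the functions [bsym] *)

Definition gram (n k j : nat) : R :=
  integral (fun x y => dual n k x y * bsym n j x y).

Lemma gram_eq n k j : (k < dtriv n)%nat -> (j < dtriv n)%nat ->
  gram n k j = 3 * integral (fun x y => bnk n (2 * half_index n j) x y * dual n k x y).
Proof.
  intros Hk Hj. unfold gram. rewrite bsym_orbit by exact Hj.
  rewrite (integral_symmetric_orbit (S n) (S n)).
  - now rewrite integral_mul_comm.
  - now apply dual_dg.
  - apply dg_bnk. now apply dtriv_index in Hj.
  - apply emon_symmetric.
Qed.

Lemma lead_dual n k : (k < dtriv n)%nat ->
  exists a, a <> 0 /\ lead (n - 2 * half_index n k) (2 * half_index n k) a (dual n k).
Proof.
  intros Hk. apply dtriv_index in Hk.
  exists ((-1) ^ (3 * half_index n k - n)). split; [apply pow_nonzero; lra|].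
  assert (E := lead_emon (3 * half_index n k - n) (n - 2 * half_index n k)).
  now replace (2 * (3 * half_index n k - n) + 2 * (n - 2 * half_index n k))%nat
    with (2 * half_index n k)%nat in E by lia.
Qed.

(** [half_index] decreases in its second argument, so for [j < k] the leading monomial of [dual n k]
    precedes that of the Jacobi function behind [bsym n j]. *)
Lemma gram_triangular n k j : (j < k)%nat -> (k < dtriv n)%nat -> gram n k j = 0.
Proof.
  intros Hjk Hk. assert (Ik := dtriv_index n k Hk).
  assert (Ij := dtriv_index n j ltac:(lia)).
  assert (Hh : (half_index n k < half_index n j)%nat) by (unfold half_index; lia).
  rewrite gram_eq by lia. rewrite integral_bnk_below; [ring | lia |].
  destruct (lead_dual n k Hk) as (a & _ & Hl).
  apply (span_ext _ (fun x y => (dual n k x y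
      - a * mon (n - 2 * half_index n k) (2 * half_index n k) x y)
      + a * mon (n - 2 * half_index n k) (2 * half_index n k) x y)); [|intros; ring].
  apply span_add.
  - revert Hl. apply span_sub. intros g (c & i & Hci & ->). apply below_mon. lia.
  - apply span_scal, below_mon. lia.
Qed.

Lemma gram_diag n k : (k < dtriv n)%nat -> gram n k k <> 0.
Proof.
  intros Hk. assert (Ik := dtriv_index n k Hk). rewrite gram_eq by lia.
  destruct (lead_dual n k Hk) as (a & Ha & Hl).
  rewrite (integral_bnk_lead _ _ a) by (lia || exact Hl).
  assert (Hp := integral_bnk_mon_pos n (2 * half_index n k) ltac:(lia)).
  repeat apply Rmult_integral_contrapositive_currified; [lra | exact Ha | lra].
Qed.

Lemma integral_dual_comb n k (c : nat -> R) : (k < dtriv n)%nat ->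
  integral (fun x y => dual n k x y * sumlt (dtriv n) (fun j => c j * bsym n j x y))
  = sumlt (dtriv n) (fun j => gram n k j * c j).
Proof.
  intros Hk. rewrite (integral_mul_sum (S n) (S n)).
  - apply sumlt_ext. intros. apply Rmult_comm.
  - now apply dual_dg.
  - intros. now apply perp_bsym.
Qed.

(** [q] is itself a combination of the [emon a b]. Those of degree [n] are duals, the others have
    lower degree, so [q] is orthogonal to itself. *)
Lemma perp_symmetric_zero n q : perp n q -> symmetric q ->
  (forall k, (k < dtriv n)%nat -> integral (fun x y => dual n k x y * q x y) = 0) ->
  forall x y, q x y = 0.
Proof.
  intros Hq Hsym H. apply (perp_sqr_zero n); [exact Hq|].
  assert (E : forall f, span (fun f => exists a b, (2 * a + 3 * b <= n)%nat /\ f = emon a b) f ->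
    integral (fun x y => q x y * f x y) = 0).
  { intros f Hf.
    assert (Hd : forall f, span (fun f => exists a b, (2 * a + 3 * b <= n)%nat /\ f = emon a b) f ->
                 dg (S n) f).
    { intros g. apply span_sub. intros h (a & b & Hab & ->). apply dg_emon. lia. }
    induction Hf as [|f (a & b & Hab & ->)|f g Hf IHf Hg IHg|t f Hf IHf].
    - apply Hq, span_0.
    - destruct (Nat.eq_dec (2 * a + 3 * b) n) as [En|En].
      + destruct (dtriv_surj n a b En) as (k & Hk & ->).
        rewrite integral_mul_comm. now apply H.
      + apply Hq, dg_emon. lia.
    - rewrite (integral_mul_add (S n) (S n)), IHf, IHg; auto; [ring | apply Hq].
    - rewrite (integral_mul_scal (S n) (S n)), IHf; auto; [ring | apply Hq]. }
  apply E, symmetric_span; [apply Hq | exact Hsym].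
Qed.

Lemma symmetric_sub f g : symmetric f -> symmetric g -> symmetric (fun x y => f x y - g x y).
Proof.
  intros [Hf Hf'] [Hg Hg']. split; intros x y.
  - change (swap f x y - swap g x y = f x y - g x y). now rewrite Hf, Hg.
  - change (refl f x y - refl g x y = f x y - g x y). now rewrite Hf', Hg'.
Qed.

Lemma symmetric_sum d (t : nat -> R) (f : nat -> fn) :
  (forall k, (k < d)%nat -> symmetric (f k)) ->
  symmetric (fun x y => sumlt d (fun k => t k * f k x y)).
Proof.
  intros H. split; intros x y; apply sumlt_ext; intros k Hk; f_equal; now apply H.
Qed.

Theorem theorem18 (n : nat) :
  (* each b^sym_{n,k} lies in the space *)
  (forall k, (k < dtriv n)%nat ->
     Pperp n (bsym n k) /\ totally_symmetric (bsym n k)) /\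
  (* linear independence *)
  (forall c : nat -> R,
     (forall x y, sumlt (dtriv n) (fun k => c k * bsym n k x y) = 0) ->
     forall k, (k < dtriv n)%nat -> c k = 0) /\
  (* spanning *)
  (forall p : R -> R -> R, Pperp n p -> totally_symmetric p ->
     exists c : nat -> R, forall x y,
       p x y = sumlt (dtriv n) (fun k => c k * bsym n k x y)).
Proof.
  split; [|split].
  - intros k Hk. split; [now apply Pperp_perp, perp_bsym|].
    now apply symmetric_totally, bsym_symmetric.
  - intros c Hc. apply (triangular_zero _ (gram n)).
    + intros. now apply gram_triangular.
    + intros. now apply gram_diag.
    (* Pairing the vanishing combination with each dual gives a homogeneous triangular system for
       [c]. *)
    + intros k Hk. rewrite <- integral_dual_comb by exact Hk.
      transitivity (integral (fun _ _ => 0)); [|apply integral_0].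
      f_equal. apply fn_ext. intros. rewrite Hc. ring.
  - intros p Hp Hs. apply Pperp_perp in Hp.
    assert (Hsym := totally_symmetric_inv _ _ (proj1 Hp) Hs).
    (* The coefficients are chosen so that the combination has the same pairings with all duals as
       [p]. *)
    destruct (triangular_solve (dtriv n) (gram n)
      (fun k j Hjk Hk => gram_triangular n k j Hjk Hk) (gram_diag n)
      (fun k => integral (fun x y => dual n k x y * p x y))) as [c Hc].
    exists c. intros x y. apply Rminus_diag_uniq.
    assert (Hq : perp n (fun x y => sumlt (dtriv n) (fun k => c k * bsym n k x y)))
      by (apply perp_sum; intros; now apply perp_bsym).
    apply (perp_symmetric_zero n
      (fun x y => p x y - sumlt (dtriv n) (fun k => c k * bsym n k x y))).
    + now apply perp_sub.
    + apply symmetric_sub; [exact Hsym|].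
      apply symmetric_sum. intros. now apply bsym_symmetric.
    + intros k Hk.
      transitivity (integral (fun x y => dual n k x y * p x y)
        - integral (fun x y => dual n k x y
                      * sumlt (dtriv n) (fun j => c j * bsym n j x y))).
      * rewrite <- (integral_sub (S n + S n));
          [| apply dg_prod; [now apply dual_dg | apply Hp]
           | apply dg_prod; [now apply dual_dg | apply Hq]].
        f_equal. apply fn_ext. intros. ring.
      * rewrite integral_dual_comb, Hc by exact Hk. ring.
Qed.
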